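(* Let $\mu$ be a nonnegative Borel measure on $\mathbb{R}^+$ with $\mu(\mathbb{R}^+)\in(0,\infty)$, let $\sigma\in C(\mathbb{R}^+;\mathbb{R})$ with $\sigma\notin L^2(0,\infty)$, let $B$ be a standard one-dimensional Brownian motion, and let $f:\mathbb{R}\to\mathbb{R}$ be locally Lipschitz continuous with $f(x)>0$ for $x>0$ and $\lim_{x\to\infty}f(x)=\infty$. Suppose there is $\phi\in C^1(\mathbb{R}^+;(0,\infty))$ with $\phi'(x)>0$ for all $x\ge0$, $\lim_{x\to\infty}\phi(x)=\infty$, $\phi'$ non-increasing with $\lim_{x\to\infty}\phi'(x)=0$, and $$\lim_{x\to\infty}\frac{f(x)}{\phi(x)}=1,\qquad\lim_{|x|\to\infty}\frac{|f(x)|}{\phi(|x|)}=1.$$ Let $X$ be the unique strong (continuous) solution of $$X(t)=X(0)+\int_0^t m(t-s)f(X(s))\,ds+\int_0^t\sigma(s)\,dB(s),\quad t\ge0,\qquad m(t)=\mu([0,t]).$$ Let $F(x)=\int_1^x\frac{du}{f(u)}$, $x>0$, $$\Sigma(t)=\sqrt{2\left(\int_0^t\sigma^2(s)\,ds\right)\log\log\left(\int_0^t\sigma^2(s)\,ds\right)},\qquad L_f(\Sigma)=\lim_{t\to\infty}\frac{\Sigma(t)}{\mu(\mathbb{R}^+)\int_{t_0}^t f(\Sigma(s))\,ds}.$$ If the limit $L_f(\Sigma)$ exists and $L_f(\Sigma)\in(0,\infty)$, then $$\limsup_{t\to\infty}\frac{F(|X(t)|)}{\mu(\mathbb{R}^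+)t}\le1+L_f(\Sigma)\quad\text{a.s.}$$
   Context: $\mathbb{R}^+=[0,\infty)$. The underlying filtered probability space is complete with right-continuous filtration, $B$ is a Brownian motion with respect to it, and $X(0)$ is a real-valued $\mathcal{F}_0$-measurable initial value. $\Sigma(t)$ is considered only for $t\ge t_0$, where $t_0$ is any fixed time with $\int_0^{t_0}\sigma^2(s)\,ds>e$ (the value of $L_f(\Sigma)$ does not depend on the choice of $t_0$). $F(0)$ is understood as $\lim_{x\to0^+}F(x)\in[-\infty,0)$. *)

(* Defs.v *)
From HB Require Import structures.
From mathcomp Require Import all_boot all_order all_algebra.
From mathcomp Require Import all_classical all_reals all_analysis.

Set Implicit Arguments.
Unset Strict Implicit.
Unset Printing Implicit Defensive.

Import Order.TTheory GRing.Theory Num.Theory.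
Import numFieldNormedType.Exports.

Local Open Scope classical_set_scope.
Local Open Scope ring_scope.

(* Functions and processes on R^+ = [0, +oo[ are represented by functions of a
   real variable; their values at negative times are never used. *)

Section real_analysis.
Context {R : realType}.
Implicit Types f g : R -> R.

Definition locally_lipschitz f :=
  forall x : R, exists2 U : set R, nbhs x U & [lipschitz f y | y in U].

(* The difference quotient is restricted to [0, +oo[, so that the derivative
   at 0 is the right derivative. *)
Definition C1_Rplus g (dg : R -> R) :=
  (forall x : R, 0 <= x ->
    (g y - g x) / (y - x) @[y --> within `[0, +oo[ (dnbhs x)] --> dg x) /\
  {within `[0, +oo[, continuous dg}.

Definition abs_pinfty_nbhs : set_system R :=
  [set A | exists M : R, forall x, M < `|x| -> A x].

Definition Fint_pos f (x : R) : R :=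
  if 1 <= x then \int[lebesgue_measure]_(u in `[1, x]) (f u)^-1
  else - \int[lebesgue_measure]_(u in `[x, 1]) (f u)^-1.

(* F(0) is the limit of F at 0+, possibly -oo; F is only evaluated on R^+. *)
Definition Fint f (x : R) : \bar R :=
  if 0 < x then (Fint_pos f x)%:E
  else lim ((Fint_pos f y)%:E @[y --> 0^'+]).

Definition variance_clock (sigma : R -> R) (t : R) : R :=
  \int[lebesgue_measure]_(s in `[0, t]) sigma s ^+ 2.

Definition Sigma (sigma : R -> R) (t : R) : R :=
  Num.sqrt (2 * variance_clock sigma t * ln (ln (variance_clock sigma t))).

End real_analysis.

Section stochastic_processes.
Context {R : realType} {d : measure_display} {T : measurableType d}.
Variable P : probability T R.
Variable Filt : R -> set (set T).
Implicit Types Y B I X : R -> T -> R.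

Definition usual_filtration :=
  [/\ forall t : R, 0 <= t -> sigma_algebra setT (Filt t),
      forall t : R, 0 <= t -> Filt t `<=` measurable,
      forall s t : R, 0 <= s -> s <= t -> Filt s `<=` Filt t,
      forall t : R, 0 <= t -> \bigcap_(u in [set u | t < u]) Filt u `<=` Filt t &
      measure_is_complete P /\ forall N, P.-negligible N -> Filt 0 N].

Definition measurable_wrt (G : set (set T)) (y : T -> R) :=
  forall A : set R, measurable A -> G (y @^-1` A).

Definition adapted Y := forall t : R, 0 <= t -> measurable_wrt (Filt t) (Y t).

Definition ae_continuous Y :=
  {ae P, forall w, {within `[0, +oo[, continuous (Y ^~ w)}}.

Definition increment B (s t : R) (w : T) : R := B t w - B s w.

Definition brownian_motion B :=
  [/\ adapted B, ae_continuous B, {ae P, forall w, B 0 w = 0},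
      forall s t : R, 0 <= s -> s < t -> forall A : set R, measurable A ->
        P (increment B s t @^-1` A)
        = normal_prob 0 (Num.sqrt (t - s)) A &
      forall s t : R, 0 <= s -> s < t ->
        forall (E : set T) (A : set R), Filt s E -> measurable A ->
        P (E `&` (increment B s t @^-1` A))
        = (P E * P (increment B s t @^-1` A))%E].

(* The process sum_(i < n) xi_i 1_]tau_i, tau_(i+1)]. *)
Record simple_process := SimpleProcess {
  sp_size : nat ;
  sp_time : nat -> R ;
  sp_coef : nat -> T -> R }.

Definition is_simple (t : R) (H : simple_process) :=
  [/\ sp_time H 0%N = 0, sp_time H (sp_size H) = t,
      forall i, (i < sp_size H)%N -> sp_time H i <= sp_time H i.+1,
      forall i, (i < sp_size H)%N ->
        measurable_wrt (Filt (sp_time H i)) (sp_coef H i) &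
      exists M : R, forall i w, (i < sp_size H)%N -> `|sp_coef H i w| <= M].

Definition simple_value (H : simple_process) (s : R) (w : T) : R :=
  \sum_(i < sp_size H)
    sp_coef H i w * \1_(`]sp_time H i, sp_time H i.+1]) s.

Definition simple_integral B (H : simple_process) (w : T) : R :=
  \sum_(i < sp_size H)
    sp_coef H i w * increment B (sp_time H i) (sp_time H i.+1) w.

(* H_n --> h in L^2(P x [0, t]), with H_n simple and adapted. *)
Definition approximates (h : R -> T -> R) (t : R) (H : nat -> simple_process) :=
  (forall n, is_simple t (H n)) /\
  (\int[P]_w \int[lebesgue_measure]_(s in `[0%R, t])
     ((h s w - simple_value (H n) s w) ^+ 2)%R%:E)%E @[n --> \oo] --> 0%E.

(* y is the Ito integral of h over [0, t]: the L^2(P) limit of the integrals of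
   any simple adapted processes which converge to h in L^2(P x [0, t]). *)
Definition is_ito_integral B (h : R -> T -> R) (t : R) (y : T -> R) :=
  [/\ measurable_fun setT y,
      exists H, approximates h t H &
      forall H, approximates h t H ->
        (\int[P]_w ((y w - simple_integral B (H n) w) ^+ 2)%R%:E)%E
          @[n --> \oo] --> 0%E].

Definition is_solution B (mu : {measure set (measurableTypeR R) -> \bar R})
    (f sigma : R -> R) X :=
  [/\ adapted X, ae_continuous X &
      exists I : R -> T -> R,
        [/\ adapted I, ae_continuous I,
            forall t : R, 0 <= t -> is_ito_integral B (fun s _ => sigma s) t (I t) &
            {ae P, forall w, forall t : R, 0 <= t ->
              X t w = X 0 w
                + \int[lebesgue_measure]_(s in `[0, t])
                    (fine (mu `[0, t - s]%classic) * f (X s w))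
                + I t w}]].

End stochastic_processes.

(* Main.v *)
(** Deterministic part. Let [M] be the total mass of [mu] and suppose
    [|I(t)| <= (1 + e) Sigma(t)] for large [t], where [I] is the stochastic
    integral. As [t = o(Sigma(t))] and [|f| <= (1 + e) phi(|.|) + C],
    [|X(t)| <= A + (1 + e) M int_0^t phi(|X|) + (1 + 2 e) Sigma(t)], while the
    existence of [L] gives
    [Sigma(t) <= A' + (1 + e)^2 L M int_0^t phi(Sigma)].
    Hence [u(t) := A'' + K1 int phi(|X|) + K2 int phi(Sigma)], with
    [K1 + K2 = (1 + L + O(e)) M], dominates both [|X|] and [Sigma]; so
    [u' <= (K1 + K2) phi(u) <= (K1 + K2) (1 + e) f(u)], and integrating
    [u' / f(u)] bounds [F(u(t))], hence [F(|X(t)|)].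

    Probabilistic part: the upper half of the law of the iterated logarithm for
    [I]. On a grid [I] is an [L^2] limit of sums of independent Gaussian
    increments, whose exponential martingale yields a maximal inequality; path
    continuity extends it to the supremum over an interval, and Borel-Cantelli
    along times at which the variance clock is geometric concludes. *)

Require Import Defs.
From HB Require Import structures.
From mathcomp Require Import all_boot all_order all_algebra.
From mathcomp Require Import all_classical all_reals all_analysis.
From mathcomp Require Import measurable_realfun.
From mathcomp Require Import ring lra.

Set Implicit Arguments.
Unset Strict Implicit.
Unset Printing Implicit Defensive.

Import Order.TTheory GRing.Theory Num.Theory.
Import numFieldNormedType.Exports.

Local Open Scope classical_set_scope.
Local Open Scope ring_scope.

(** * Primitives and comparison *)

Section interval_integrals.
Context {R : realType}.
Implicit Types (h g f : R -> R) (a b c t x y : R).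
Notation leb := (@lebesgue_measure R).

(** The comparison runs through [phi] because [f] need not be monotone: only for a nondecreasing
    function do [|X| <= u] and [Sigma <= u] pass to the values at [u]. Rewriting the forcing term
    [Sigma] as an integral of [phi(Sigma)] makes it part of the derivative of [u], so an integral
    inequality with forcing becomes an autonomous differential inequality; this is where the summand
    [L] of [1 + L] originates.

    It is proved for discretized sums and transferred at the finitely many points of a fixed grid,
    while the discretization is refined. The price is a slightly lower level [a' < a], which the
    slack [e] of the iterated logarithm pays for. *)

Lemma within_itvcc_sub (D : set R) h a b :
  (forall x, a <= x <= b -> D x) -> {within D, continuous h} ->
  {within `[a, b], continuous h}.
Proof. by move=> abD; apply: continuous_subspaceW => x /=; rewrite in_itv/=; exact: abD. Qed.

Lemma within_integrable h a b : {within `[a, b], continuous h} ->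
  leb.-integrable `[a, b] (EFin \o h).
Proof. by move=> ch; apply: continuous_compact_integrable => //; exact: segment_compact. Qed.

Lemma continuous_integrable h a b : continuous h ->
  leb.-integrable `[a, b] (EFin \o h).
Proof. by move=> ch; apply: within_integrable; exact: continuous_subspaceT. Qed.

Lemma Rintegral_cat h a b c : a <= b -> b <= c ->
  leb.-integrable `[a, c] (EFin \o h) ->
  \int[leb]_(s in `[a, c]) h s =
  \int[leb]_(s in `[a, b]) h s + \int[leb]_(s in `[b, c]) h s.
Proof.
move=> ab bc ih.
have := @Rintegral_itvB R h (BLeft a) (BRight c) b ih.
rewrite !bnd_simp => /(_ ab bc) H.
rewrite -(Rintegral_itv_obnd_cbnd (r := b)).
  by rewrite -H addrC subrK.
apply: integrableS ih => //=.
by apply: subset_itvr; rewrite bnd_simp.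
Qed.

Lemma Rintegral_le_itv h a b c : (forall s, a <= s <= c -> 0 <= h s) ->
  a <= b -> b <= c -> leb.-integrable `[a, c] (EFin \o h) ->
  \int[leb]_(s in `[a, b]) h s <= \int[leb]_(s in `[a, c]) h s.
Proof.
move=> h0 ab bc ih; rewrite (Rintegral_cat ab bc ih) lerDl.
apply: Rintegral_ge0 => s /=; rewrite in_itv/= => /andP[bs sc].
by apply: h0; rewrite (le_trans ab bs).
Qed.

Lemma is_derive_primitive h a x : continuous h -> a < x ->
  is_derive x 1 (fun y => \int[leb]_(s in `[a, y]) h s) (h x).
Proof.
move=> ch ax; have xx1 : x < x + 1 by rewrite ltrDl.
have [dF EF] := continuous_FTC1_closed xx1 (continuous_integrable _ _ ch) ax (ch x).
by apply: DeriveDef; [exact: dF|rewrite -derive1E; exact: EF].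
Qed.

Lemma primitive_split h a b x : continuous h -> a <= b -> b <= x ->
  \int[leb]_(s in `[b, x]) h s =
  \int[leb]_(s in `[a, x]) h s - \int[leb]_(s in `[a, b]) h s.
Proof.
move=> ch ab bx; rewrite (Rintegral_cat ab bx); first by rewrite addrC addKr.
exact: continuous_integrable.
Qed.

Lemma continuous_mull h c : continuous h -> continuous (fun s => c * h s).
Proof. by move=> ch s; apply: cvgM; [exact: cvg_cst|exact: ch]. Qed.

Lemma continuous_add h g : continuous h -> continuous g ->
  continuous (fun s => h s + g s).
Proof. by move=> ch cg s; apply: cvgD; [exact: ch|exact: cg]. Qed.

(** Freezing the argument at [c] extends [h] by the constant [h c]. Continuity relative to a
    half-line becomes global continuity, and primitives of the extension have two-sided derivatives
    even at [c]. *)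
Lemma continuous_maxl h c : {within `[c, +oo[, continuous h} ->
  continuous (fun x => h (Num.max x c)).
Proof.
move=> /subspace_continuousP ch x.
have cm : continuous (fun y : R => Num.max y c).
  by move=> y; apply: continuous_max; [exact: cvg_id|exact: cvg_cst].
have Dx y : `[c, +oo[%classic (Num.max y c) by rewrite /= in_itv/= le_max lexx orbT.
move=> A /(ch _ (Dx x)) /= wA.
have /cm wA' : nbhs (Num.max x c) (fun z => `[c, +oo[%classic z -> A (h z)) := wA.
by apply: (@filterS _ (nbhs x) _ _ _ _ wA') => y /=; apply; exact: Dx.
Qed.

(** Separation of variables: with [u' = g <= K f(u)] and [G] a primitive of [1 / f], the function
    [K s - G(u(s))] is nondecreasing. The bound [1 <= a] keeps [u] where [Fint_pos] is given by its
    first branch. *)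
Lemma growth_comparison f g a K T t : 1 <= a -> 0 <= K ->
  (forall x, 0 < x -> 0 < f x) -> continuous f -> continuous g ->
  (forall s, 0 <= g s) ->
  (forall s, T <= s -> g s <= K * f (a + \int[leb]_(r in `[T, s]) g r)) ->
  T <= t ->
  Fint_pos f (a + \int[leb]_(r in `[T, t]) g r) <= Fint_pos f a + K * (t - T).
Proof.
move=> a1 K0 f0 cf cg g0 gf Tt.
set u := fun s => a + \int[leb]_(r in `[T, s]) g r.
have u0 s : a <= u s by rewrite /u lerDl; apply: Rintegral_ge0.
have u1 s : 1 <= u s by exact: le_trans (u0 s).
(* Cutting off at 1 makes [1 / f] continuous on the whole line without changing it at the values of
   [u]; its primitive starts at 0 so that 1 is an interior point. *)
pose h x := (f (Num.max x 1))^-1.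
have h0 x : 0 < h x by rewrite invr_gt0 f0// lt_max ltr01 orbT.
have ch : continuous h.
  move=> x; apply: cvgV; first by rewrite gt_eqF// f0// lt_max ltr01 orbT.
  apply: (@continuous_comp _ _ _ (fun x => Num.max x 1) f); last exact: cf.
  by apply: continuous_max; [exact: cvg_id|exact: cvg_cst].
pose G y := \int[leb]_(s in `[0, y]) h s.
have FG y : 1 <= y -> Fint_pos f y = G y - G 1.
  move=> y1; rewrite /Fint_pos y1 -(primitive_split (b:=1))//.
  apply: eq_Rintegral => s; rewrite inE/= in_itv/= => /andP[s1 _].
  by rewrite /h max_l.
(* Starting the primitive at [T - 1] gives a two-sided derivative at [T]; [w] below coincides with
   [u] from [T] on. *)
pose v s := \int[leb]_(r in `[T - 1, s]) g r.
have uv s : T <= s -> u s = a + (v s - v T).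
  move=> Ts; rewrite /u (@primitive_split g (T - 1))//.
  by rewrite lerBlDr lerDl.
pose w s := a + (v s - v T).
pose D s := K * s - G (w s).
have dw s : T - 1 < s -> is_derive s 1 w (g s).
  move=> Ts; have dv := is_derive_primitive cg Ts.
  have := is_deriveD (is_derive_cst a s 1) (is_deriveB dv (is_derive_cst (v T) s 1)).
  by rewrite add0r subr0.
have w0 s : T <= s -> 0 < w s by move=> Ts; rewrite /w -uv//; exact: lt_le_trans (u1 s).
have dD s : T <= s -> is_derive s 1 D (K - h (w s) * g s).
  move=> Ts; have Ts' : T - 1 < s by rewrite (lt_le_trans _ Ts)// ltrBlDr ltrDl.
  have dG := is_derive1_comp (is_derive_primitive ch (w0 _ Ts)) (dw _ Ts').
  have dK : is_derive s 1 (fun r : R => K * r) K.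
    have := is_deriveZ K (is_derive_id s (1 : R)).
    by rewrite /GRing.scale/= mulr1.
  exact: is_deriveB dK dG.
have : D T <= D t.
  apply: (@ger0_derive1_ndecr R D T t) => //.
  - by move=> s; rewrite in_itv/= => /andP[/ltW/dD Ts _]; exact: ex_derive.
  - move=> s; rewrite in_itv/= => /andP[/ltW Ts _].
    rewrite derive1E (@derive_val _ _ _ _ _ _ _ (dD _ Ts)) subr_ge0.
    rewrite /h /w -uv// max_l// ler_pdivrMl; last by rewrite f0// (lt_le_trans _ (u1 s)).
    by rewrite mulrC; exact: gf.
  - apply: derivable_within_continuous => s; rewrite in_itv/= => /andP[Ts _].
    by have ? := dD _ Ts; exact: ex_derive.
rewrite /D /w -!uv// -[X in a + X]/(\int[leb]_(r in `[T, t]) g r) -/(u t).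
have -> : u T = a by rewrite uv// subrr addr0.
rewrite !FG//; lra.
Qed.

End interval_integrals.

(** * Growth of a single path *)

Section path_growth.
Context {R : realType}.
Implicit Types (h g f : R -> R) (a b c t x y : R).
Notation leb := (@lebesgue_measure R).

Lemma near_pinftyP (P : R -> Prop) :
  (\forall t \near +oo, P t) <-> exists T, forall t, T <= t -> P t.
Proof.
split=> [[T [_ HT]]|[T HT]].
  by exists (T + 1) => t Tt; apply: HT; rewrite (lt_le_trans _ Tt)// ltrDl.
by exists T; split; [exact: num_real|move=> t /ltW; exact: HT].
Qed.

Lemma Rintegral_cst_itv a b c : a <= b -> \int[leb]_(s in `[a, b]) c = c * (b - a).
Proof.
move=> ab; rewrite Rintegral_cst//= lebesgue_measure_itv/= lte_fin.
by move: ab; rewrite le_eqVlt => /predU1P[->|->]; rewrite ?ltxx ?subrr ?mulr0.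
Qed.

Lemma Fint_pos_ge0 f u : (forall x, 0 < x -> 0 < f x) -> 1 <= u -> 0 <= Fint_pos f u.
Proof.
move=> f0 u1; rewrite /Fint_pos u1; apply: Rintegral_ge0 => s /=.
rewrite in_itv/= => /andP[s1 _]; rewrite invr_ge0 ltW// f0//; exact: lt_le_trans s1.
Qed.

Lemma Fint_pos_le0 f y : (forall x, 0 < x -> 0 < f x) -> 0 < y -> y < 1 -> Fint_pos f y <= 0.
Proof.
move=> f0 y0 y1; rewrite /Fint_pos (leNgt 1) y1/= oppr_le0; apply: Rintegral_ge0 => s /=.
rewrite in_itv/= => /andP[ys _]; rewrite invr_ge0 ltW// f0//; exact: lt_le_trans ys.
Qed.

(** Below 1 the function [F] is at most 0, and from 1 on it is at least 0; so signs alone settle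
    [y < 1], including the value at 0, and monotonicity is left for [1 <= y]. *)
Lemma Fint_le f y u : continuous f -> (forall x, 0 < x -> 0 < f x) ->
  0 <= y -> y <= u -> 1 <= u -> (Fint f y <= (Fint_pos f u)%:E)%E.
Proof.
move=> cf f0 y0 yu u1; rewrite /Fint; case: ifPn => [{}y0|].
  rewrite lee_fin; have [y1|y1] := leP 1 y; last first.
    by rewrite (le_trans (Fint_pos_le0 f0 y0 y1))// Fint_pos_ge0.
  rewrite /Fint_pos y1 u1; apply: Rintegral_le_itv => //.
    by move=> s /andP[s1 _]; rewrite invr_ge0 ltW// f0// (lt_le_trans _ s1).
  apply: within_integrable; apply: continuous_in_subspaceT => s.
  rewrite inE/= in_itv/= => /andP[s1 _]; apply: cvgV; last exact: cf.
  by rewrite gt_eqF// f0// (lt_le_trans _ s1).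
(* Without a limit at 0+, [lim] would be the junk value [point = 0]. *)
move=> _; have [cF|/dvgP->] := pselect (cvg ((Fint_pos f y)%:E @[y --> 0^'+])); last first.
  by rewrite lee_fin Fint_pos_ge0.
apply: lime_le => //; near=> z; rewrite lee_fin.
rewrite (@le_trans _ _ 0)// ?Fint_pos_ge0//; apply: Fint_pos_le0 => //.
Unshelve. all: by end_near. Qed.

(** Far out the quotient is below [1 + e]; on the remaining compact interval the maximum of [|f|]
    serves as [C]. *)
Lemma asymptotic_affine_bound f (phi : R -> R) e : 0 < e -> continuous f ->
  (forall x, 0 <= x -> 0 < phi x) ->
  `|f x| / phi `|x| @[x --> abs_pinfty_nbhs] --> (1 : R) ->
  exists2 C, 0 <= C & forall y, `|f y| <= (1 + e) * phi `|y| + C.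
Proof.
move=> e0 cf phi0 /(_ _ (nbhsx_ballx (1 : R) _ e0))[M /= HM].
have N0 : - Num.max M 0 <= Num.max M 0 by rewrite ge0_cp// le_max lexx orbT.
have cnf : {within `[- Num.max M 0, Num.max M 0], continuous (fun y => `|f y|)}.
  by apply: continuous_subspaceT => y; apply: cvg_norm; exact: cf.
have [c _ Hc] := EVT_max N0 cnf.
exists `|f c| => // y; have [yM|My] := leP `|y| (Num.max M 0).
  apply: ler_wpDl; first by rewrite mulr_ge0// ?addr_ge0// ltW// phi0.
  by apply: Hc; rewrite in_itv/= -ler_norml.
rewrite ler_wpDr// -ler_pdivrMr; last exact: phi0.
have /HM : M < `|y| by rewrite (le_lt_trans _ My)// le_max lexx.
by rewrite /ball/= ltr_norml => /andP[H _]; lra.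
Qed.

Lemma path_growth (M L t0 A : R) f (phi S x I : R -> R) eta :
  0 < M -> 0 < L -> 0 <= t0 -> 0 < eta ->
  continuous f -> (forall x, 0 < x -> 0 < f x) -> f x @[x --> +oo] --> +oo ->
  {within `[0, +oo[, continuous phi} ->
  (forall x, 0 <= x -> 0 < phi x) ->
  (forall x y, 0 <= x -> x <= y -> phi x <= phi y) ->
  f x / phi x @[x --> +oo] --> (1 : R) ->
  `|f x| / phi `|x| @[x --> abs_pinfty_nbhs] --> (1 : R) ->
  {within `[t0, +oo[, continuous S} -> (forall t, 0 <= S t) -> S t @[t --> +oo] --> +oo ->
  S t / (M * \int[leb]_(s in `[t0, t]) f (S s)) @[t --> +oo] --> L ->
  {within `[0, +oo[, continuous x} ->
  (forall t, 0 <= t -> `|x t| <= A + M * \int[leb]_(s in `[0, t]) `|f (x s)| + `|I t|) ->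
  (forall e, 0 < e -> \forall t \near +oo, `|I t| <= (1 + e) * S t) ->
  \forall t \near +oo, (Fint f `|x t| <= ((1 + L + eta) * (M * t))%:E)%E.
Proof.
move=> M0 L0 t00 eta0 cf f0 fy cphi phi0 phi_nd fphi afphi cS S0 Sy SL cx xA Ie.
(* Times [M], the left side is the final rate [(K1 + K2) * (1 + e)]. For [e <= 1] every power of [e]
   is at most [e], so it exceeds [1 + L] by at most [(3 + 23 * L) * e], where 3 = 2 + 1 and 23 = 5 +
   9 + 7 + 2 add up the coefficients. The other half of [eta] is kept for the constant
   [Fint_pos f a]. *)
have [e [e0 e1 eeta]] : exists e, [/\ 0 < e, e <= 1 &
    (1 + e) ^+ 2 + L * (1 + 2 * e) * (1 + e) ^+ 3 <= 1 + L + eta / 2].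
  pose d := Num.min 1 (eta / (2 * (3 + 23 * L))).
  have D0 : 0 < 3 + 23 * L by lra.
  have d0 : 0 < d by rewrite lt_min ltr01/= divr_gt0// mulr_gt0.
  have d1 : d <= 1 by rewrite ge_min lexx.
  exists d; split => //.
  have : d <= eta / (2 * (3 + 23 * L)) by rewrite ge_min lexx orbT.
  rewrite ler_pdivlMr ?mulr_gt0// => H.
  have d2 : d ^+ 2 <= d by rewrite expr2 ler_piMr// ltW.
  have d3 : d ^+ 3 <= d by rewrite exprS (le_trans _ d2)// expr2 ler_wpM2l ?(ltW d0).
  have d4 : d ^+ 4 <= d by rewrite exprS (le_trans _ d2)// expr2 ler_wpM2l ?(ltW d0).
  have E : (1 + 2 * d) * (1 + d) ^+ 3 = 1 + 5 * d + 9 * d ^+ 2 + 7 * d ^+ 3 + 2 * d ^+ 4.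
    by ring.
  have : L * ((1 + 2 * d) * (1 + d) ^+ 3) <= L * (1 + 23 * d).
    by rewrite ler_wpM2l ?(ltW L0)// E; lra.
  rewrite mulrA; have -> : (1 + d) ^+ 2 = 1 + 2 * d + d ^+ 2 by ring.
  lra.
have [C C0 HC] := asymptotic_affine_bound e0 cf phi0 afphi.
have [T1 HT1] := (near_pinftyP _).1 (Ie _ e0).
have fpos K : exists T, forall t, T <= t -> K <= f (S t).
  apply/near_pinftyP; have /cvgryPge/(_ K) := cvg_comp _ _ Sy fy; exact.
have cS' : continuous (fun s => S (Num.max s t0)) by exact: continuous_maxl.
pose fS s := f (S (Num.max s t0)).
have cfS : continuous fS by move=> s; exact: (continuous_comp (cS' s) (cf _)).
have fSE t : \int[leb]_(s in `[t0, t]) f (S s) = \int[leb]_(s in `[t0, t]) fS s.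
  by apply: eq_Rintegral => s; rewrite inE/= in_itv/= => /andP[st0 _]; rewrite /fS max_l.
pose J t := \int[leb]_(s in `[t0, t]) fS s.
have Jcat a b : t0 <= a -> a <= b -> J b = J a + \int[leb]_(s in `[a, b]) fS s.
  by move=> ta ab; rewrite /J (Rintegral_cat ta ab)//; exact: continuous_integrable.
(* As [f (S t)] tends to infinity, its integral outgrows every linear function. This makes the
   denominator of the quotient positive and, since [L > 0], gives [t = o(S t)]. *)
have Jlin K : exists T, forall t, T <= t -> K * t <= J t.
  have [T HT] := fpos (`|K| + 1).
  pose T' := Num.max T t0.
  have HT' t : T' <= t -> J T' + (`|K| + 1) * (t - T') <= J t.
    move=> Tt; rewrite (Jcat T' t)//; last by rewrite le_max lexx orbT.
    rewrite lerD2l.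
    have -> : (`|K| + 1) * (t - T') = \int[leb]_(s in `[T', t]) (`|K| + 1).
      by rewrite Rintegral_cst_itv.
    apply: le_Rintegral => //=.
    - by apply: continuous_integrable => ?; exact: cvg_cst.
    - exact: continuous_integrable.
    move=> s /=; rewrite in_itv/= => /andP[Ts _]; apply: HT.
    by rewrite le_max (le_trans _ Ts)// le_max lexx.
  exists (Num.max T' (`|J T'| + (`|K| + 1) * T')) => t; rewrite ge_max => /andP[/HT' + H].
  apply: le_trans.
  have t0' : 0 <= t.
    apply: le_trans H; rewrite addr_ge0// mulr_ge0//.
    by rewrite le_max t00 orbT.
  have := ler_wpM2r t0' (ler_norm K); have := ler_norm (- J T'); rewrite normrN.
  lra.
have SLJ : S t / (M * J t) @[t --> +oo] --> L.
  by move: SL; under eq_fun do rewrite fSE.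
have [T2 HT2] : exists T, forall t, T <= t -> S t <= (1 + e) * L * (M * J t) /\
                                               L / 2 * (M * J t) <= S t.
  have [T HT] := Jlin 1.
  have /near_pinftyP[Ta HTa] : \forall t \near +oo, L / 2 < S t / (M * J t).
    by apply: (cvgr_gt _ SLJ); lra.
  have /near_pinftyP[Tb HTb] : \forall t \near +oo, S t / (M * J t) < (1 + e) * L.
    by apply: (cvgr_lt _ SLJ); rewrite mulrDl mul1r ltrDl mulr_gt0.
  exists (Num.max (Num.max T 1) (Num.max Ta Tb)) => t.
  rewrite !ge_max => /andP[/andP[/HT tJ t1] /andP[/HTa ta /HTb tb]].
  have J0 : 0 < M * J t by rewrite mulr_gt0//; lra.
  by split; [rewrite -ler_pdivrMr// ltW|rewrite -ler_pdivlMr// ltW].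
have [T3 HT3] : exists T, forall t, T <= t -> f (S t) <= (1 + e) * phi (S t).
  have /near_pinftyP[v Hv] : \forall v \near +oo, f v / phi v < 1 + e.
    by apply: (cvgr_lt _ fphi); rewrite ltrDl.
  have /near_pinftyP[T HT] : \forall t \near +oo, v <= S t by move/cvgryPge: Sy; exact.
  by exists T => t /HT/Hv /ltW; rewrite ler_pdivrMr// phi0.
(* The additive constant [C] contributes [M * C * t] to the drift; absorbing it in [e * S t] turns
   the factor [1 + e] of [S] into [1 + 2 * e]. *)
have [T4 HT4] : exists T, forall t, T <= t -> M * C * t <= e * S t.
  have [T HT] := Jlin (C / (e * (L / 2))).
  exists (Num.max T T2) => t; rewrite ge_max => /andP[/HT H /HT2[_ H2]].
  have := ler_wpM2l (ltW e0) H2; apply: le_trans.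
  move: H; rewrite mulrAC ler_pdivrMr ?mulr_gt0 ?divr_gt0// => H.
  by have := ler_wpM2l (ltW M0) H; lra.
have [N1 HN] : exists N, forall v, N <= v -> phi v <= (1 + e) * f v.
  have e'1 : (1 + e)^-1 < 1 by rewrite invf_lt1 ?ltrDl// ltr_wpDr// ltW.
  have [N HN] := (near_pinftyP _).1 (cvgr_gt _ fphi _ e'1).
  exists (Num.max N 0) => v; rewrite ge_max => /andP[/HN H /phi0 v0].
  by move: H; rewrite ltr_pdivlMr// mulrC ltr_pdivrMr ?ltr_wpDr ?(ltW e0)// mulrC => /ltW.
pose T := Num.max (Num.max T1 T2) (Num.max (Num.max T3 T4) t0).
have TP t : T <= t -> [/\ T1 <= t, T2 <= t, T3 <= t, T4 <= t & t0 <= t].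
  by rewrite !ge_max => /andP[/andP[-> ->] /andP[/andP[-> ->] ->]].
have [_ _ _ _ t0T] := TP _ (lexx T).
have T0 : 0 <= T by exact: le_trans t0T.
pose phi' y := phi (Num.max y 0).
have cphi' : continuous phi' by exact: continuous_maxl.
have phi'E y : 0 <= y -> phi' y = phi y by move=> y0; rewrite /phi' max_l.
have phi'0 y : 0 < phi' y by rewrite phi0// le_max lexx orbT.
have cx' : continuous (fun s : R => `|x (Num.max s 0)|).
  by move=> s; apply: cvg_norm; exact: (continuous_maxl cx).
pose p s := phi' `|x (Num.max s 0)|; pose q s := phi' (S (Num.max s t0)).
have cp : continuous p by move=> s; exact: (continuous_comp (cx' s) (cphi' _)).
have cq : continuous q by move=> s; exact: (continuous_comp (cS' s) (cphi' _)).
(* [K1] is the total mass times the loss from [|f|] to [phi]. [K2] multiplies the factor [1 + 2 * e]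
   of [S] by the constant [(1 + e) ^+ 2 * L * M] that bounds [S] by an integral of [phi (S)]. *)
pose K1 := M * (1 + e); pose K2 := (1 + 2 * e) * (1 + e) ^+ 2 * L * M.
have K10 : 0 <= K1 by rewrite /K1 mulr_ge0 ?(ltW M0)//; lra.
have K20 : 0 <= K2.
  by rewrite /K2 mulr_ge0 ?(ltW M0)// mulr_ge0 ?(ltW L0)// mulr_ge0 ?sqr_ge0//; lra.
pose g s := K1 * p s + K2 * q s.
have cg : continuous g.
  by apply: continuous_add; apply: continuous_mull.
have p0 s : 0 < p s by exact: phi'0.
have q0 s : 0 < q s by exact: phi'0.
have g0 s : 0 <= g s by rewrite /g addr_ge0// mulr_ge0// ltW.
(* [a0] and [b0] hold what was accumulated before [T]. The initial value [a] also exceeds [N1], so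
   that [phi <= (1 + e) f] along [u], and 1, as [growth_comparison] demands. *)
pose a0 := A + K1 * \int[leb]_(s in `[0, T]) p s.
pose b0 := (1 + e) * L * (M * J T).
pose a := Num.max 1 (Num.max N1 (`|a0| + (1 + 2 * e) * `|b0|)).
have a1 : 1 <= a by rewrite le_max lexx.
pose u t := a + \int[leb]_(r in `[T, t]) g r.
have uE t : u t = a + (K1 * \int[leb]_(r in `[T, t]) p r + K2 * \int[leb]_(r in `[T, t]) q r).
  rewrite /u RintegralD//= ?RintegralZl//=; try exact: continuous_integrable.
  - by apply: continuous_integrable; apply: continuous_mull.
  - by apply: continuous_integrable; apply: continuous_mull.
have Su t : T <= t -> S t <= b0 + (1 + e) ^+ 2 * L * M * \int[leb]_(r in `[T, t]) q r.
  move=> Tt; have [tT1 tT2 tT3 tT4 tt0] := TP _ Tt.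
  have [/le_trans + _] := HT2 _ tT2; apply.
  rewrite (Jcat T t)// mulrDr mulrDr lerD2l expr2.
  have LM : 0 <= (1 + e) * (L * M) by rewrite mulr_ge0 ?mulr_ge0 ?(ltW L0) ?(ltW M0)//; lra.
  have : \int[leb]_(s in `[T, t]) fS s <= \int[leb]_(s in `[T, t]) ((1 + e) * q s).
    apply: le_Rintegral => //=; try exact: continuous_integrable.
      by apply: continuous_integrable; apply: continuous_mull.
    move=> s /=; rewrite in_itv/= => /andP[Ts _]; rewrite /q phi'E//.
    have [_ _ sT3 _ st0] := TP _ Ts.
    by rewrite /fS max_l//; exact: HT3.
  rewrite RintegralZl//; last exact: continuous_integrable.
  by move/(ler_wpM2l LM); lra.
have xu t : T <= t -> `|x t| <= a0 + K1 * \int[leb]_(r in `[T, t]) p r + (1 + 2 * e) * S t.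
  move=> Tt; have [tT1 tT2 tT3 tT4 tt0] := TP _ Tt.
  have t_0 : 0 <= t by exact: le_trans Tt.
  have If : \int[leb]_(s in `[0, t]) `|f (x s)| <=
     (1 + e) * (\int[leb]_(s in `[0, T]) p s + \int[leb]_(s in `[T, t]) p s) + C * t.
    apply: (@le_trans _ _ (\int[leb]_(s in `[0, t]) ((1 + e) * p s + C))).
      apply: le_Rintegral => //=.
      - apply: within_integrable.
        apply: (@within_continuous_comp _ _ _ _ x (fun y => `|f y|)).
          by move=> y _; apply: cvg_norm; exact: cf.
        by apply: within_itvcc_sub cx => s /andP[s0 _]; rewrite /= in_itv/= s0.
      - apply: continuous_integrable; apply: continuous_add; first exact: continuous_mull.
        by move=> s; exact: cvg_cst.
      move=> s /=; rewrite in_itv/= => /andP[s0 _].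
      by rewrite /p phi'E// max_l.
    rewrite RintegralD//=; last 2 first.
    - by apply: continuous_integrable; apply: continuous_mull.
    - by apply: continuous_integrable => s; exact: cvg_cst.
    rewrite RintegralZl//; last exact: continuous_integrable.
    rewrite Rintegral_cst_itv// subr0 (Rintegral_cat (h := p) T0 Tt)//.
    exact: continuous_integrable.
  apply: (le_trans (le_trans (xA t t_0)
    (lerD (lerD (lexx A) (ler_wpM2l (ltW M0) If)) (HT1 _ tT1)))).
  have arith (P0 P1 c s : R) : M * C * c <= e * s ->
      A + M * ((1 + e) * (P0 + P1) + C * c) + (1 + e) * s <=
      A + M * (1 + e) * P0 + M * (1 + e) * P1 + (1 + 2 * e) * s.
    by lra.
  exact: arith (HT4 _ tT4).
have e20 : 0 <= 1 + 2 * e by lra.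
have pos (r : R -> R) t : (forall s, 0 < r s) -> 0 <= \int[leb]_(s in `[T, t]) r s.
  by move=> r0; apply: Rintegral_ge0 => s _; exact: ltW.
have aE : `|a0| + (1 + 2 * e) * `|b0| <= a by rewrite !le_max lexx !orbT.
have b0e : 0 <= e * `|b0| by rewrite mulr_ge0// ltW.
have b0le : (1 + 2 * e) * b0 <= (1 + 2 * e) * `|b0| by rewrite ler_wpM2l// ler_norm.
have xu' t : T <= t -> `|x t| <= u t.
  move=> Tt; apply: (le_trans (xu _ Tt)); rewrite uE.
  have arith (P Q s : R) : s <= b0 + (1 + e) ^+ 2 * L * M * Q ->
      a0 + K1 * P + (1 + 2 * e) * s <= a + (K1 * P + K2 * Q).
    move=> /(ler_wpM2l e20); have := ler_norm a0; rewrite /K2; lra.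
  exact: arith (Su _ Tt).
have Su' t : T <= t -> S t <= u t.
  move=> Tt; apply: (le_trans (Su _ Tt)); rewrite uE.
  have arith (P Q : R) : 0 <= P -> 0 <= Q ->
      b0 + (1 + e) ^+ 2 * L * M * Q <= a + (K1 * P + K2 * Q).
    move=> /(mulr_ge0 K10) P0 Q0.
    have := ler_norm b0; have := normr_ge0 a0.
    have : 0 <= e * ((1 + e) ^+ 2 * L * M * Q).
      rewrite mulr_ge0 ?(ltW e0)// mulr_ge0// mulr_ge0 ?(ltW M0)//.
      by rewrite mulr_ge0 ?sqr_ge0 ?(ltW L0).
    rewrite /K2; lra.
  by apply: arith; exact: pos.
have ua t : a <= u t by rewrite /u lerDl; apply: Rintegral_ge0.
have K0 : 0 <= (K1 + K2) * (1 + e) by rewrite mulr_ge0 ?addr_ge0//; lra.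
have gu s : T <= s -> g s <= (K1 + K2) * (1 + e) * f (u s).
  move=> Ts; have [_ _ _ _ st0] := TP _ Ts.
  have s0 : 0 <= s by exact: le_trans Ts.
  have pu : p s <= phi (u s) by rewrite /p phi'E// max_l// phi_nd// xu'.
  have qu : q s <= phi (u s) by rewrite /q phi'E// max_l// phi_nd// Su'.
  have Nu : N1 <= u s by rewrite (le_trans _ (ua s))// !le_max lexx orbT.
  have := ler_wpM2l (addr_ge0 K10 K20) (HN _ Nu); rewrite [X in _ <= X]mulrA.
  apply: le_trans; rewrite /g mulrDl.
  by apply: lerD; rewrite ler_wpM2l.
(* Past this threshold [Fint_pos f a] is at most [eta / 2 * (M * t)], the unspent half of [eta]. *)
apply/near_pinftyP; exists (Num.max T (`|Fint_pos f a| / (eta / 2 * M))) => t.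
rewrite ge_max => /andP[Tt].
rewrite ler_pdivrMr; last by rewrite !mulr_gt0// divr_gt0.
move=> Ht; have u1 : 1 <= u t by exact: le_trans (ua t).
apply: (le_trans (Fint_le cf f0 (normr_ge0 _) (xu' _ Tt) u1)).
rewrite lee_fin; have := growth_comparison a1 K0 f0 cf cg g0 gu Tt.
move=> /le_trans; apply.
have := ler_norm (Fint_pos f a).
have : 0 <= (K1 + K2) * (1 + e) * T by rewrite mulr_ge0.
have t_0 : 0 <= M * t by rewrite mulr_ge0 ?(ltW M0)//; exact: le_trans Tt.
have := ler_wpM2r t_0 eeta.
have -> : ((1 + e) ^+ 2 + L * (1 + 2 * e) * (1 + e) ^+ 3) * (M * t) = (K1 + K2) * (1 + e) * t.
  by rewrite /K1 /K2; ring.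
lra.
Qed.

End path_growth.

(** * The variance clock *)

Section C1_Rplus_facts.
Context {R : realType}.
Variables (g dg : R -> R).
Implicit Types x y : R.
Hypothesis gC1 : C1_Rplus g dg.

(** Near [x] the difference quotient within the half-line is at distance less than 1 from [dg x], so
    the increment of [g] is at most [(|dg x| + 1) |x - y|]. *)
Lemma C1_Rplus_continuous : {within `[0, +oo[, continuous g}.
Proof.
apply/subspace_continuousP => x; rewrite /= in_itv/= andbT => x0.
apply/cvgrPdist_lt => eps eps0.
have [e /= e0 He] := gC1.1 x x0 _ (nbhsx_ballx (dg x) _ ltr01).
have k0 : 0 < `|dg x| + 1 by rewrite ltr_wpDl.
exists (Num.min e (eps / (`|dg x| + 1))) => /=; first by rewrite lt_min e0 divr_gt0.
move=> y /=; rewrite lt_min ltr_pdivlMr// => /andP[ye yeps] y0.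
have [->|yx] := eqVneq y x; first by rewrite subrr normr0.
have {}He : `|dg x - (g y - g x) / (y - x)| < 1 by exact: (He y ye yx y0).
have yx0 : y - x != 0 by rewrite subr_eq0.
suff H : `|g x - g y| <= `|x - y| * (`|dg x| + 1) by exact: le_lt_trans yeps.
rewrite distrC (distrC x) -[X in `|X| <= _](divfK yx0) normrM mulrC ler_wpM2l//.
rewrite -[X in `|X|](subrK (dg x)) addrC (le_trans (ler_normD _ _))// lerD2l.
by rewrite distrC ltW.
Qed.

Lemma C1_Rplus_is_derive x : 0 < x -> is_derive x 1 g (dg x).
Proof.
move=> x0; have gx := gC1.1 x (ltW x0).
have H : h^-1 *: (g (h *: (1 : R) + x) - g x) @[h --> 0^'] --> dg x.
  have hx : h *: (1 : R) + x @[h --> 0^'] --> within `[0, +oo[ (dnbhs x).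
    move=> A /= [e /= e0 He]; exists (Num.min e x) => /=; first by rewrite lt_min e0.
    move=> h /=; rewrite sub0r normrN lt_min => /andP[he hx] h0.
    rewrite /GRing.scale/= mulr1; apply: He => /=.
    - by rewrite opprD addrCA subrr addr0 normrN.
    - by rewrite -subr_eq0 addrK.
    - by rewrite in_itv/= andbT; move: hx; rewrite ltr_norml => /andP[]; lra.
  rewrite (_ : (fun h => _) =
      (fun y => (g y - g x) / (y - x)) \o (fun h : R => h *: (1 : R) + x)).
    exact: cvg_comp _ _ hx gx.
  by apply/funext => h; rewrite /= /GRing.scale/= mulr1 addrK mulrC.
have dH : derivable g x 1 by apply/cvg_ex; exists (dg x).
apply: DeriveDef => //.
exact/cvg_lim.
Qed.

Hypothesis dg0 : forall x, 0 <= x -> 0 < dg x.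

Lemma C1_Rplus_nondecreasing x y : 0 <= x -> x <= y -> g x <= g y.
Proof.
move=> x0 xy; have [dD Dg] : (forall z, z \in `]x, y[ -> derivable g z 1) /\
    (forall z, z \in `]x, y[ -> 0 <= derive1 g z).
  split=> z; rewrite in_itv/= => /andP[xz _].
    by have D := C1_Rplus_is_derive (le_lt_trans x0 xz); exact: ex_derive.
  have D := C1_Rplus_is_derive (le_lt_trans x0 xz).
  by rewrite derive1E (@derive_val _ _ _ _ _ _ _ D) ltW// dg0// ltW// (le_lt_trans x0).
apply: (ger0_derive1_ndecr dD Dg) => //.
by apply: within_itvcc_sub C1_Rplus_continuous => z /andP[xz _]; rewrite /= in_itv/= (le_trans x0).
Qed.

End C1_Rplus_facts.

Section variance_clock_facts.
Context {R : realType}.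
Variables (sigma : R -> R).
Hypothesis csigma : {within `[0, +oo[, continuous sigma}.
Notation V := (variance_clock sigma).
Notation leb := (@lebesgue_measure R).
Implicit Types s t : R.

Lemma within_sqr_sigma t :
  {within `[0, t], continuous (fun s => sigma s ^+ 2)}.
Proof.
apply: (@within_continuous_comp _ _ _ _ sigma (fun y => y ^+ 2)).
  by move=> y _; exact: exprn_continuous.
by apply: within_itvcc_sub csigma => s /andP[s0 _]; rewrite /= in_itv/= s0.
Qed.

Lemma integrable_sqr_sigma t : leb.-integrable `[0, t] (fun s => (sigma s ^+ 2)%:E).
Proof. exact/within_integrable/within_sqr_sigma. Qed.

Let sg s := sigma (Num.max s 0) ^+ 2.

Let csg : continuous sg.
Proof.
move=> s; apply: (@continuous_comp _ _ _ (fun y : R => sigma (Num.max y 0)) (fun y => y ^+ 2)).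
  exact: continuous_maxl.
exact: exprn_continuous.
Qed.

Let VE t : V t = \int[leb]_(s in `[0, t]) sg s.
Proof.
apply: eq_Rintegral => s; rewrite inE/= in_itv/= => /andP[s0 _].
by rewrite /sg max_l.
Qed.

Lemma variance_clock_ge0 t : 0 <= V t.
Proof. by apply: Rintegral_ge0 => s _; exact: sqr_ge0. Qed.

Lemma variance_clock_nd s t : s <= t -> V s <= V t.
Proof.
move=> st; rewrite !VE; have [s0|s0] := leP 0 s.
  apply: Rintegral_le_itv => //; first by move=> ? _; exact: sqr_ge0.
  exact: continuous_integrable.
rewrite set_itv_ge ?bnd_simp -?ltNge// Rintegral_set0.
by apply: Rintegral_ge0 => ? _; exact: sqr_ge0.
Qed.

Lemma variance_clock_le0 t : t <= 0 -> V t = 0.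
Proof.
rewrite le_eqVlt => /predU1P[->|t0]; first by rewrite /V set_itv1 Rintegral_set1.
by rewrite /V set_itv_ge ?bnd_simp -?ltNge// Rintegral_set0.
Qed.

Lemma variance_clock_continuous t : 0 < t -> {for t, continuous V}.
Proof.
move=> t0; have [dV _] := is_derive_primitive csg t0.
have -> : V = fun t => \int[leb]_(s in `[0, t]) sg s by apply/funext => ?; exact: VE.
by apply: differentiable_continuous; exact/derivable1_diffP.
Qed.

Lemma variance_clock_EFin t :
  (\int[leb]_(s in `[0%R, t]) (sigma s ^+ 2)%:E)%E = (V t)%:E.
Proof. by rewrite fineK//; exact/integrable_fin_num/integrable_sqr_sigma. Qed.

Hypothesis sigmaN : ~ leb.-integrable `]0, +oo[ (fun s => (sigma s ^+ 2)%:E).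

(** If the nondecreasing [V] stayed below some [K], monotone convergence along []0, n]] would bound
    the integral of [sigma ^+ 2] over the half-line by [K], against [sigmaN]. *)
Lemma variance_clock_cvgy : V t @[t --> +oo] --> +oo.
Proof.
apply/cvgryPge => K; apply: contrapT => VK; apply: sigmaN.
have {}VK t : V t <= K.
  rewrite leNgt; apply/negP => Kt; apply: VK; apply/near_pinftyP; exists t => s ts.
  by rewrite ltW// (lt_le_trans Kt)// variance_clock_nd.
pose F (n : nat) : set R := `]0, n%:R]%classic.
pose h : R -> \bar R := EFin \o (fun s => sigma s ^+ 2).
have ms : measurable_fun (`]0, +oo[ : set R) h.
  apply/measurable_EFinP; apply: measurable_funX.
  apply: (@measurable_funS _ _ _ _ (`[0, +oo[ : set R)) => //.
    by apply: subset_itvr; rewrite bnd_simp.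
  exact: subspace_continuous_measurable_fun.
have UF : (`]0, +oo[%classic : set R) = \bigcup_n F n.
  apply/seteqP; split => x /=.
    rewrite in_itv/= andbT => x0; exists (Num.truncn x).+1 => //; rewrite /F/= in_itv/= x0/= ltW//.
    exact: truncnS_gt.
  by move=> [n _]; rewrite /F/= !in_itv/= => /andP[->].
apply/integrableP; split => //.
under eq_integral do rewrite abse_EFin ger0_norm ?sqr_ge0//.
rewrite UF; apply: (@le_lt_trans _ _ K%:E); last exact: ltry.
have mF i : measurable_fun (F i) h.
  apply: measurable_funS ms => //.
  by move=> x; rewrite /F/= !in_itv/= => /andP[->].
have ndF : nondecreasing_seq F.
  move=> m n mn; apply/subsetPset => x; rewrite /F/= !in_itv/= => /andP[-> xm]/=.
  by rewrite (le_trans xm)// ler_nat.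
have mFi i : measurable (F i) by exact: measurable_itv.
have F0 i x : F i x -> (0 <= (sigma x ^+ 2)%:E)%E by rewrite lee_fin sqr_ge0.
have Fcvg := ge0_nondecreasing_set_cvg_integral (mu := leb) ndF mFi mF F0.
rewrite -(cvg_lim _ Fcvg)//; apply: lime_le; first by apply/cvg_ex; eexists; exact: Fcvg.
apply: nearW => n; rewrite (@le_trans _ _ (V n%:R)%:E) ?lee_fin//.
rewrite -variance_clock_EFin; apply: ge0_subset_integral => //=.
- exact: mFi.
- by have /integrableP[] := integrable_sqr_sigma n%:R.
- by move=> x _; rewrite lee_fin sqr_ge0.
- by move=> x; rewrite /F/= !in_itv/= => /andP[/ltW -> ->].
Qed.

(** [V] may have flat stretches where [sigma] vanishes, so chosen preimages stand in for an inverse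
    clock. *)
Lemma variance_clock_surj a v : 0 < a -> V a <= v -> exists2 t, a <= t & V t = v.
Proof.
move=> a0 av; have /cvgryPge/(_ v)/near_pinftyP[b Hb] := variance_clock_cvgy.
have ab : a <= Num.max a b by rewrite le_max lexx.
have [||c + Vc] := @IVT R V a (Num.max a b) v ab.
- apply: continuous_in_subspaceT => s; rewrite inE/= in_itv/= => /andP[sa _].
  exact/variance_clock_continuous/(lt_le_trans a0).
- have vb : v <= V (Num.max a b) by apply: Hb; rewrite le_max lexx orbT.
  by rewrite ge_min av/= le_max vb orbT.
- by rewrite in_itv/= => /andP[ac _]; exists c.
Qed.

Variable t0 : R.
Hypothesis t0e : expR 1 < V t0.
Notation S := (Sigma sigma).

Lemma clock_start_gt0 : 0 < t0.
Proof.
rewrite ltNge; apply/negP => /variance_clock_le0 V0.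
by move: t0e; rewrite V0 ltNge expR_ge0.
Qed.

Lemma Sigma_continuous : {within `[t0, +oo[, continuous S}.
Proof.
apply: continuous_in_subspaceT => t; rewrite inE/= in_itv/= andbT => tt0.
have cV := variance_clock_continuous (lt_le_trans clock_start_gt0 tt0).
have eV : expR 1 < V t by rewrite (lt_le_trans t0e)// variance_clock_nd.
have V0 : 0 < V t by rewrite (lt_trans _ eV)// expR_gt0.
have lV : 0 < ln (V t) by rewrite (lt_trans ltr01)// -[ltLHS]expRK ltr_ln// posrE expR_gt0.
apply: (@continuous_comp _ _ _ (fun t => 2 * V t * ln (ln (V t))) Num.sqrt); last exact: sqrt_continuous.
apply: cvgM; first by apply: cvgM; [exact: cvg_cst|exact: cV].
apply: (@continuous_comp _ _ _ (fun t => ln (V t)) (@ln R)); last exact: continuous_ln.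
by apply: (@continuous_comp _ _ _ V (@ln R)); [exact: cV|exact: continuous_ln].
Qed.

Lemma Sigma_nd s t : t0 <= s -> s <= t -> S s <= S t.
Proof.
move=> t0s st; rewrite /Sigma; apply: ler_wsqrtr.
have es : expR 1 < V s by rewrite (lt_le_trans t0e)// variance_clock_nd.
have st' := variance_clock_nd st.
have s0 : 0 < V s by rewrite (lt_trans _ es)// expR_gt0.
have t_0 : 0 < V t by exact: lt_le_trans st'.
have ls : 1 < ln (V s) by rewrite -[ltLHS]expRK ltr_ln// posrE expR_gt0.
have lst : ln (V s) <= ln (V t) by rewrite ler_ln.
have ls0 : 0 < ln (V s) by rewrite (lt_trans ltr01).
have lt0 : 0 < ln (V t) by rewrite (lt_le_trans ls0).
apply: ler_pM; [by rewrite mulr_ge0// ltW|by rewrite ln_ge0// ltW|by rewrite ler_pM2l|].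
by rewrite ler_ln.
Qed.

Lemma Sigma_cvgy : S t @[t --> +oo] --> +oo.
Proof.
apply/cvgryPge => K; apply/near_pinftyP.
have /cvgryPge/(_ (Num.max (expR (expR 1)) (K ^+ 2)))/near_pinftyP[T HT] := variance_clock_cvgy.
exists T => t /HT; rewrite ge_max => /andP[eV KV].
have V0 : 0 < V t by rewrite (lt_le_trans _ eV)// expR_gt0.
have lV : expR 1 <= ln (V t) by rewrite -[leLHS]expRK ler_ln// posrE expR_gt0.
have llV : 1 <= ln (ln (V t)).
  by rewrite -[leLHS]expRK ler_ln// posrE ?expR_gt0// (lt_le_trans _ lV)// expR_gt0.
rewrite (le_trans (ler_norm K))// -sqrtr_sqr /Sigma ler_wsqrtr// (le_trans KV)//.
rewrite -[leLHS]mulr1 ler_pM// ?(ltW V0)//.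
by rewrite ler_peMl ?(ltW V0)// ler1n.
Qed.

End variance_clock_facts.

(** * A maximal inequality for sums of Brownian increments *)

Section normal_moments.
Context {R : realType}.
Notation leb := (@lebesgue_measure R).
Local Open Scope ereal_scope.

(** The Radon-Nikodym derivative of the normal law agrees almost everywhere with [normal_pdf],
    because both have the same integral over every measurable set. *)
Lemma ge0_integral_normal_prob (m s : R) (f : R -> \bar R) :
  measurable_fun setT f -> (forall x, 0 <= f x) ->
  \int[normal_prob m s]_x f x = \int[leb]_x (f x * (normal_pdf m s x)%:E).
Proof.
move=> mf f0; have dom := normal_prob_dominates m s.
rewrite -(Radon_Nikodym_SigmaFinite.change_of_variables dom)//.
have ifrn := Radon_Nikodym_SigmaFinite.f_integrable dom.
have mpdf : measurable_fun [set: R] (EFin \o normal_pdf m s).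
  by apply/measurable_EFinP; exact: measurable_normal_pdf.
apply: ae_eq_integral => //.
- by apply: emeasurable_funM => //; exact: (measurable_int leb).
- exact: emeasurable_funM.
apply: ae_eqe_mul2l; apply: integral_ae_eq => //.
by move=> E _ mE; rewrite -(Radon_Nikodym_SigmaFinite.f_integral dom).
Qed.

(** Completing the square: [expR (th * x)] times the centred density is a constant times the density
    with mean [th * s ^+ 2]. *)
Lemma normal_prob_mgf (s th : R) : (0 < s)%R ->
  \int[normal_prob 0 s]_x (expR (th * x))%:E = (expR (th ^+ 2 * s ^+ 2 / 2))%:E.
Proof.
move=> s0; rewrite ge0_integral_normal_prob; last 2 first.
- apply/measurable_EFinP; apply: (measurableT_comp (@measurable_expR R)).
  exact: mulrl_measurable.
- by move=> x; rewrite lee_fin expR_ge0.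
transitivity (\int[leb]_x
    ((expR (th ^+ 2 * s ^+ 2 / 2))%:E * (normal_pdf (th * s ^+ 2) s x)%:E)).
  apply: eq_integral => x _; rewrite -!EFinM; congr EFin.
  rewrite !normal_pdfE ?gt_eqF// mulrCA [RHS]mulrCA; congr (_ * _)%R.
  rewrite /normal_fun -!expRD; congr expR.
  by field; rewrite gt_eqF.
rewrite integralZl//; last exact: integrable_normal_pdf.
by rewrite integral_normal_pdf mule1.
Qed.

End normal_moments.

(** * Expectation of a product of independent variables *)

Section independent_expectation.
Context {R : realType} {d : measure_display} {T : measurableType d}.
Variable P : probability T R.
Local Open Scope ereal_scope.

(** Independence says that the law of [(Y, Z)] agrees with the product of the two laws on
    rectangles, hence everywhere; Tonelli then splits the integral. *)
Lemma ge0_integral_indep (Y Z : T -> R) :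
  measurable_fun setT Y -> measurable_fun setT Z ->
  (forall w, 0 <= Y w)%R -> (forall w, 0 <= Z w)%R ->
  (forall A B : set R, measurable A -> measurable B ->
    P ((Y @^-1` A) `&` (Z @^-1` B)) = P (Y @^-1` A) * P (Z @^-1` B)) ->
  \int[P]_w (Y w * Z w)%:E = \int[P]_w (Y w)%:E * \int[P]_w (Z w)%:E.
Proof.
move=> mY mZ Y0 Z0 YZ.
have mW : measurable_fun setT (fun w => (Y w, Z w)) by exact/measurable_fun_pairP.
pose Y' : {mfun T >-> R} := HB.pack Y (isMeasurableFun.Build _ _ _ _ Y mY).
pose Z' : {mfun T >-> R} := HB.pack Z (isMeasurableFun.Build _ _ _ _ Z mZ).
pose W' : {mfun T >-> (R * R)%type} :=
  HB.pack (fun w => (Y w, Z w)) (isMeasurableFun.Build _ _ _ _ _ mW).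
pose m1 := distribution P Y'; pose m2 := distribution P Z'.
(* The absolute value changes nothing on the range of [(Y, Z)] and makes the integrand nonnegative
   on the whole plane, as Tonelli requires. *)
pose F (p : R * R) : \bar R := (`|p.1 * p.2|)%:E.
have mabs : measurable_fun [set: R] (fun y : R => `|y|%:E).
  by apply/measurable_EFinP; exact: normr_measurable.
have mF : measurable_fun [set: R * R] F.
  apply/measurable_EFinP; apply: measurableT_comp => //.
  by apply: measurable_funM; [exact: measurable_fst|exact: measurable_snd].
have F0 p : 0 <= F p by rewrite /F lee_fin.
have FE y z : F (y, z) = `|y|%:E * `|z|%:E by rewrite /F/= normrM EFinM.
transitivity (\int[P]_w (F \o W') w).
  by apply: eq_integral => w _; rewrite /F/= ger0_norm// mulr_ge0.
rewrite -(ge0_integral_distribution W')//.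
transitivity (\int[m1 \x m2]_p F p).
  apply: eq_measure_integral => A mA _; apply/esym.
  exact: product_measure_unique.
rewrite fubini_tonelli1//=.
rewrite /fubini_F/=.
under eq_integral do under eq_integral do rewrite FE.
under eq_integral do rewrite ge0_integralZl//.
rewrite ge0_integralZr//; last by apply: integral_ge0.
rewrite !ge0_integral_distribution//=.
by congr (_ * _); apply: eq_integral => w _; rewrite ger0_norm.
Qed.

End independent_expectation.

Section wrt_measurability.
Context {R : realType} {d : measure_display} {T : measurableType d}.
Implicit Types (G : set (set T)) (y z : T -> R).

(** A sigma-algebra equals the one it generates; regarding it as the structure of a measurable type
    opens the closure properties of measurable functions to [measurable_wrt]. *)
Lemma measurable_wrtP G y : sigma_algebra setT G ->
  measurable_wrt G y <-> measurable_fun setT (y : g_sigma_algebraType G -> R).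
Proof.
move=> sG; have mG := measurable_g_measurableTypeE sG.
split=> [my _ A mA|my A mA]; first by rewrite setTI [measurable]mG; exact: my.
by have := my measurableT A mA; rewrite setTI [measurable]mG.
Qed.

Lemma measurable_wrtW G y : G `<=` measurable -> measurable_wrt G y ->
  measurable_fun setT y.
Proof. by move=> Gm my _ A mA; rewrite setTI; apply: Gm; exact: my. Qed.

Lemma measurable_wrt_cst G (r : R) : sigma_algebra setT G -> measurable_wrt G (fun=> r).
Proof. by move=> sG; apply/measurable_wrtP => //; exact: measurable_cst. Qed.

End wrt_measurability.

Section brownian_sums.
Context {R : realType} {d : measure_display} {T : measurableType d}.
Variables (P : probability T R) (Filt : R -> set (set T)) (B : R -> T -> R).
Implicit Types (s t : R) (Y y : T -> R).
Hypotheses (uF : usual_filtration P Filt) (bB : brownian_motion P Filt B).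

Let sF t : 0 <= t -> sigma_algebra setT (Filt t).
Proof. by case: uF => + _ _ _ _; exact. Qed.
Let mF t : 0 <= t -> Filt t `<=` measurable.
Proof. by case: uF => _ + _ _ _; exact. Qed.
Let ndF s t : 0 <= s -> s <= t -> Filt s `<=` Filt t.
Proof. by case: uF => _ _ + _ _; exact. Qed.

Lemma measurable_wrt_Filt_le s t y : 0 <= s -> s <= t ->
  measurable_wrt (Filt s) y -> measurable_wrt (Filt t) y.
Proof. by move=> s0 st my A mA; apply: (ndF s0 st); exact: my. Qed.

Lemma measurable_increment s t : 0 <= s -> s <= t ->
  measurable_wrt (Filt t) (increment B s t).
Proof.
case: bB => aB _ _ _ _ s0 st; have t0 := le_trans s0 st.
apply/measurable_wrtP; first exact: sF.
apply: measurable_funB; apply/measurable_wrtP; [exact: sF|exact: aB|exact: sF|].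
by apply: (measurable_wrt_Filt_le s0 st); exact: aB.
Qed.

Local Open Scope ereal_scope.

Lemma increment_mgf s t (th : R) : (0 <= s)%R -> (s < t)%R ->
  \int[P]_w (expR (th * increment B s t w))%:E = (expR (th ^+ 2 * (t - s) / 2))%:E.
Proof.
move=> s0 st; have t0 : (0 <= t)%R by rewrite (le_trans s0)// ltW.
have mI : measurable_fun setT (increment B s t).
  by apply: (measurable_wrtW (mF t0)); apply: measurable_increment => //; exact: ltW.
have mI' : measurable_fun setT (increment B s t : T -> measurableTypeR R) by exact: mI.
pose I' : {mfun T >-> measurableTypeR R} :=
  HB.pack (increment B s t) (isMeasurableFun.Build _ _ _ _ _ mI').
have st0 : (0 < Num.sqrt (t - s))%R by rewrite sqrtr_gt0 subr_gt0.
have me : measurable_fun [set: measurableTypeR R] (fun x : R => (expR (th * x))%:E).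
  apply/measurable_EFinP; apply: (measurableT_comp (@measurable_expR R)).
  exact: mulrl_measurable.
have := normal_prob_mgf th st0; rewrite sqr_sqrtr ?subr_ge0 ?(ltW st)// => <-.
rewrite -[LHS](ge0_integral_distribution I' me); last by move=> x; rewrite lee_fin expR_ge0.
apply: eq_measure_integral => A mA _.
by case: bB => _ _ _ + _; apply.
Qed.

(** The increment is independent of [Filt s], so its exponential factors out. This is the martingale
    property of [exp(th B(t) - th^2 t / 2)], tested against [Y]. *)
Lemma increment_exp_martingale s t (th : R) Y : (0 <= s)%R -> (s < t)%R ->
  measurable_wrt (Filt s) Y -> (forall w, 0 <= Y w)%R ->
  \int[P]_w (Y w * expR (th * increment B s t w))%:E =
  \int[P]_w (Y w)%:E * (expR (th ^+ 2 * (t - s) / 2))%:E.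
Proof.
move=> s0 st mY Y0; rewrite -(increment_mgf th s0 st).
have t0 : (0 <= t)%R by rewrite (le_trans s0)// ltW.
have mI : measurable_fun setT (increment B s t).
  by apply: (measurable_wrtW (mF t0)); apply: measurable_increment => //; exact: ltW.
have me : measurable_fun [set: R] (fun x : R => expR (th * x)).
  by apply: (measurableT_comp (@measurable_expR R)); exact: mulrl_measurable.
apply: ge0_integral_indep => //.
- exact: (measurable_wrtW (mF s0)).
- exact: (measurableT_comp me mI).
move=> A C mA mC; case: bB => _ _ _ _ indep.
pose C' := (fun x : R => expR (th * x)) @^-1` C.
have mC' : measurable C' by rewrite -[C']setTI; exact: me.
by have := indep s t s0 st (Y @^-1` A) C' (mY A mA) mC'.
Qed.

Variables (tau c : nat -> R).
Hypotheses (tau0 : tau 0%N = 0%R) (tau_lt : forall k, (tau k < tau k.+1)%R).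

Definition brownian_sum k w := (\sum_(j < k) c j * increment B (tau j) (tau j.+1) w)%R.
Definition sum_variance k := (\sum_(j < k) c j ^+ 2 * (tau j.+1 - tau j))%R.
Notation S := brownian_sum.
Notation V := sum_variance.

Let tau_ge0 k : (0 <= tau k)%R.
Proof.
by elim: k => [|k IH]; [rewrite tau0|rewrite (le_trans IH)// ltW].
Qed.

Lemma brownian_sumS k w : S k.+1 w = (S k w + c k * increment B (tau k) (tau k.+1) w)%R.
Proof. by rewrite /S big_ord_recr. Qed.

Lemma measurable_brownian_sum k : measurable_wrt (Filt (tau k)) (S k).
Proof.
elim: k => [|k IH].
  rewrite (_ : S 0 = fun=> 0%R); first exact: (measurable_wrt_cst 0%R (sF (tau_ge0 0))).
  by apply/funext => w; rewrite /S big_ord0.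
have kk1 := ltW (tau_lt k); have k0 := tau_ge0 k; have sk1 := sF (tau_ge0 k.+1).
rewrite (_ : S k.+1 = fun w => S k w + c k * increment B (tau k) (tau k.+1) w)%R; last first.
  by apply/funext => w; exact: brownian_sumS.
apply/measurable_wrtP => //; apply: measurable_funD.
  by apply/measurable_wrtP => //; exact: (measurable_wrt_Filt_le k0 kk1).
apply: measurable_funM; first exact: measurable_cst.
by apply/measurable_wrtP => //; exact: measurable_increment.
Qed.

Variables (a la : R).
Hypothesis (a0 : (0 <= a)%R) (la0 : (0 <= la)%R).

(** The event that the level [a] has not been crossed up to step [k]; these events do the work of a
    stopping time. *)
Definition below_level k := [set w | forall j, (j <= k)%N -> (S j w <= a)%R].
Notation N := below_level.

Lemma below_levelS k : N k.+1 = N k `&` [set w | (S k.+1 w <= a)%R].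
Proof.
apply/seteqP; split=> w /= => [H|[H1 H2] j].
  by split=> [j jk|]; apply: H => //; exact: leq_trans jk _.
by rewrite leq_eqVlt => /predU1P[->//|]; rewrite ltnS; exact: H1.
Qed.

Lemma measurable_below_level k : Filt (tau k) (N k).
Proof.
have mle j : Filt (tau j) [set w | (S j w <= a)%R].
  rewrite (_ : [set w | _] = S j @^-1` `]-oo, a]); last first.
    by apply/seteqP; split=> w /=; rewrite in_itv.
  by apply: measurable_brownian_sum; exact: measurable_itv.
elim: k => [|k IH].
  rewrite (_ : N 0 = [set w | (S 0 w <= a)%R])//.
  apply/seteqP; split=> w /=; first exact.
  by move=> H j; rewrite leqn0 => /eqP->.
rewrite below_levelS; have sk1 := sF (tau_ge0 k.+1).
have mG := measurable_g_measurableTypeE sk1.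
rewrite -mG; apply: measurableI; rewrite mG; last exact: mle.
exact: (ndF (tau_ge0 k) (ltW (tau_lt k))).
Qed.

Lemma brownian_sum_maximal n :
  P (~` N n) <= (expR (la ^+ 2 * V n / 2 - la * a))%:E.
Proof.
have mN k : measurable (N k) by exact/(mF (tau_ge0 k))/measurable_below_level.
have mS k : measurable_fun setT (S k).
  exact: (measurable_wrtW (mF (tau_ge0 k)) (measurable_brownian_sum k)).
(* The compensator counts the variance still to come: the exponent starts at [la ^+ 2 * V n / 2]
   and, as [kap] is nonnegative up to step [n], is at least [la * a] at a crossing. *)
pose kap k := (la ^+ 2 * (V n - V k) / 2)%R.
pose Y k w := (\1_(N k) w * expR (la * S k w + kap k))%R.
pose A k w := (\1_(~` N k) w * expR (la * a))%R.
have Y0 k w : (0 <= Y k w)%R by rewrite mulr_ge0 ?expR_ge0.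
have A0 k w : (0 <= A k w)%R by rewrite mulr_ge0 ?expR_ge0.
have VS k : V k.+1 = (V k + c k ^+ 2 * (tau k.+1 - tau k))%R by rewrite /V big_ord_recr.
have Vnd k m : (k <= m)%N -> (V k <= V m)%R.
  elim: m => [|m IH]; first by rewrite leqn0 => /eqP->.
  rewrite leq_eqVlt => /predU1P[->//|]; rewrite ltnS => /IH /le_trans; apply.
  by rewrite VS lerDl mulr_ge0 ?sqr_ge0// subr_ge0 ltW.
have mA k : measurable_fun setT (A k).
  by apply: measurable_funM => //; apply: measurable_indic; exact: measurableC.
have mel k x : measurable_fun setT (fun w => expR (la * S k w + x)).
  apply: (measurableT_comp (@measurable_expR R)); apply: measurable_funD => //.
  by apply: measurable_funM.
have mY k : measurable_fun setT (Y k).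
  by apply: measurable_funM; [exact: measurable_indic|exact: mel].
(* [A k + Y k] is the exponential supermartingale frozen at [expR (la * a)] when
   the level [a] is crossed. *)
have step k : (k < n)%N ->
    \int[P]_w (A k.+1 w + Y k.+1 w)%:E <= \int[P]_w (A k w + Y k w)%:E.
  move=> kn; pose Z w := expR (la * c k * increment B (tau k) (tau k.+1) w).
  pose Dk := ((la * c k) ^+ 2 * (tau k.+1 - tau k) / 2)%R.
  have kapS : kap k = (kap k.+1 + Dk)%R by rewrite /kap /Dk VS; field.
  (* All of the next exponential except the new increment, hence measurable for [Filt (tau k)]; the
     factor [expR Dk] coming from the increment restores [kap k]. *)
  pose Y' w := (\1_(N k) w * expR (la * S k w + kap k.+1))%R.
  have Y'0 w : (0 <= Y' w)%R by rewrite mulr_ge0 ?expR_ge0.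
  have mY' : measurable_fun setT Y'.
    by apply: measurable_funM; [exact: measurable_indic|exact: mel].
  have wY' : measurable_wrt (Filt (tau k)) Y'.
    have sk := sF (tau_ge0 k).
    apply/measurable_wrtP => //; apply: measurable_funM.
      apply: measurable_indic; rewrite [measurable](measurable_g_measurableTypeE sk).
      exact: measurable_below_level.
    apply: (measurableT_comp (@measurable_expR R)); apply: measurable_funD => //.
    apply: measurable_funM => //.
    by apply/measurable_wrtP => //; exact: measurable_brownian_sum.
  have mZ : measurable_fun setT Z.
    apply: (measurableT_comp (@measurable_expR R)); apply: measurable_funM => //.
    apply: (measurable_wrtW (mF (tau_ge0 k.+1))).
    by apply: measurable_increment => //; exact: ltW.
  apply: (@le_trans _ _ (\int[P]_w (A k w + Y' w * Z w)%:E)).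
    apply: ge0_le_integral => //.
    - by move=> w _; rewrite lee_fin addr_ge0.
    - by apply/measurable_EFinP; exact: measurable_funD.
    - by apply/measurable_EFinP; apply: measurable_funD => //; exact: measurable_funM.
    move=> w _; rewrite lee_fin /A /Y /Y' /Z -mulrA -expRD !indicE !in_setC.
    have kap0 : (0 <= kap k.+1)%R.
      by rewrite /kap divr_ge0// mulr_ge0 ?sqr_ge0// subr_ge0 Vnd.
    have -> : (la * S k w + kap k.+1 + la * c k * increment B (tau k) (tau k.+1) w =
               la * S k.+1 w + kap k.+1)%R by rewrite brownian_sumS; ring.
    rewrite below_levelS in_setI; case: (w \in N k) => /=; last first.
      by rewrite !mul0r !addr0.
    have [Sa|Sa] := leP (S k.+1 w) a.
      by rewrite mem_set//= !mul0r !mul1r.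
    rewrite memNset /=; last by apply/negP; rewrite -ltNge.
    rewrite !mul0r !mul1r addr0 add0r ler_expR.
    by rewrite (le_trans (ler_wpM2l la0 (ltW Sa)))// lerDl.
  rewrite le_eqVlt; apply/orP; left; apply/eqP.
  have mEA : measurable_fun setT (fun w => (A k w)%:E) by exact/measurable_EFinP.
  have mEY : measurable_fun setT (fun w => (Y k w)%:E) by exact/measurable_EFinP.
  have mEY' : measurable_fun setT (fun w => (Y' w)%:E) by exact/measurable_EFinP.
  have mEYZ : measurable_fun setT (fun w => (Y' w * Z w)%:E).
    by apply/measurable_EFinP; exact: measurable_funM.
  have EA0 w : setT w -> 0 <= (A k w)%:E by move=> _; rewrite lee_fin.
  have EY0 w : setT w -> 0 <= (Y k w)%:E by move=> _; rewrite lee_fin.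
  have EY'0 w : setT w -> 0 <= (Y' w)%:E by move=> _; rewrite lee_fin.
  have EYZ0 w : setT w -> 0 <= (Y' w * Z w)%:E.
    by move=> _; rewrite lee_fin mulr_ge0// expR_ge0.
  have eD0 : 0 <= (expR Dk)%:E by rewrite lee_fin expR_ge0.
  transitivity (\int[P]_w ((A k w)%:E + (Y' w * Z w)%:E)).
    by apply: eq_integral => w _; rewrite EFinD.
  transitivity (\int[P]_w ((A k w)%:E + (Y k w)%:E)); last first.
    by apply: eq_integral => w _; rewrite EFinD.
  rewrite (ge0_integralD P measurableT EA0 mEA EYZ0 mEYZ).
  rewrite (ge0_integralD P measurableT EA0 mEA EY0 mEY); congr (_ + _).
  rewrite /Z (increment_exp_martingale _ (tau_ge0 k) (tau_lt k) wY' Y'0).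
  rewrite -(ge0_integralZr P measurableT mEY' EY'0 eD0).
  apply: eq_integral => w _; rewrite -EFinM; congr EFin.
  by rewrite /Y' /Y kapS -[LHS]mulrA -expRD addrA.
have main k : (k <= n)%N -> \int[P]_w (A k w + Y k w)%:E <= (expR (la ^+ 2 * V n / 2))%:E.
  elim: k => [_|k IH kn]; last by rewrite (le_trans (step k kn))// IH// ltnW.
  have N0 : N 0 = setT.
    apply/seteqP; split=> // w _ j; rewrite leqn0 => /eqP->.
    by rewrite /S big_ord0.
  rewrite (eq_integral (cst (expR (la ^+ 2 * V n / 2))%:E)); last first.
    move=> w _; rewrite /A /Y N0 setCT !indicE in_set0 in_setT mul0r mul1r add0r.
    by rewrite /kap /S big_ord0 mulr0 add0r /V big_ord0 subr0.
  by rewrite integral_cst//= probability_setT mule1.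
have := main n (leqnn n).
suff: (expR (la * a))%:E * P (~` N n) <= \int[P]_w (A n w + Y n w)%:E.
  move=> H1 H2; have := le_trans H1 H2.
  rewrite expRD expRN EFinM -lee_pdivlMl ?expR_gt0//.
  by rewrite muleC.
have mC : measurable (~` N n) by exact: measurableC.
rewrite -(setIT (~` N n)) -integral_indic// -ge0_integralZl//; last first.
  exact/measurable_EFinP/measurable_indic.
apply: ge0_le_integral => //.
- by apply: measurable_funeM; exact/measurable_EFinP/measurable_indic.
- by apply/measurable_EFinP; exact: measurable_funD.
- by move=> w _; rewrite -EFinM lee_fin /A mulrC lerDl.
Qed.


End brownian_sums.

(** * Passage to the Ito integral *)

Section deterministic_integrand.
Context {R : realType}.
Notation leb := (@lebesgue_measure R).
Implicit Types (g : R -> R) (tau c : nat -> R) (s t : R).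

Lemma ge0_cvge0P (u : nat -> \bar R) : (forall n, (0 <= u n)%E) ->
  u n @[n --> \oo] --> 0%E <->
  (forall e : R, 0 < e -> \forall n \near \oo, (u n <= e%:E)%E).
Proof.
move=> u0; split=> [/fine_cvgP[uf /cvgrPdist_lt uc] e e0|H].
  near=> n; have ufn : u n \is a fin_num by near: n.
  rewrite -(fineK ufn) lee_fin.
  have : `|0 - fine (u n)| < e by near: n; exact: uc.
  by rewrite sub0r normrN => /ltW; apply: le_trans; exact: ler_norm.
apply/fine_cvgP; split.
  by apply: filterS (H 1 ltr01) => n un; rewrite ge0_fin_numE// (le_lt_trans un)// ltry.
apply/cvgrPdist_le => e e0; apply: filterS (H e e0) => n un.
rewrite sub0r normrN ger0_norm ?fine_ge0// -lee_fin fineK//.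
by rewrite ge0_fin_numE// (le_lt_trans un)// ltry.
Unshelve. all: by end_near. Qed.

(** Heine-Cantor through compactness as a near-covering property. Only [x] is confined to the
    interval. *)
Lemma uniform_continuity_itv g t e : continuous g -> 0 < e ->
  exists2 del, 0 < del & forall x y, 0 <= x -> x <= t -> `|x - y| < del -> `|g x - g y| <= e.
Proof.
move=> cg e0.
have /compact_near_coveringP/(_ R (0 : R)^'+
    (fun del x => forall y, `|x - y| < del -> `|g x - g y| <= e)) H := @segment_compact R 0 t.
have {}H : \forall del \near (0 : R)^'+, `[0, t] `<=`
    (fun x => forall y, `|x - y| < del -> `|g x - g y| <= e).
  apply: H => x0 _.
  have /cvgrPdist_lt/(_ (e / 2)) := cg x0; rewrite divr_gt0// => /(_ isT)[r /= r0 Hr].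
  exists (ball x0 (r / 2), [set del | 0 < del < r / 2]) => /=.
    split; first by apply: nbhsx_ballx; rewrite divr_gt0.
    have r20 : 0 < r / 2 by rewrite divr_gt0.
    by apply: filterS2 (nbhs_right_gt 0) (nbhs_right_lt r20) => del /= -> ->.
  move=> [x del] [/= xx0 /andP[del0 delr]] y xy.
  rewrite -(subrK (g x0) (g x)) -addrA (le_trans (ler_normD _ _))//.
  have Hx : `|g x0 - g x| < e / 2.
    by apply: Hr => /=; rewrite (lt_trans xx0)// ltr_pdivrMr// ltr_pMr// ltr1n.
  have Hy : `|g x0 - g y| < e / 2.
    apply: Hr => /=; rewrite -(subrK x x0) -addrA (le_lt_trans (ler_normD _ _))//.
    by rewrite (splitr r) ltrD// (lt_trans xy).
  by rewrite distrC in Hx; rewrite (splitr e) lerD// ltW.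
have [del /= [del0 Hd]] : exists del, 0 < del /\ `[0, t] `<=`
    (fun x => forall y, `|x - y| < del -> `|g x - g y| <= e).
  near (0 : R)^'+ => del; exists del; split; first by near: del; exact: nbhs_right_gt.
  by near: del.
exists del => // x y x0 xt; apply: Hd; by rewrite /= in_itv/= x0.
Unshelve. all: by end_near. Qed.

Lemma step_valueP tau c k s : (forall j, tau j <= tau j.+1) ->
  tau 0%N < s -> s <= tau k ->
  exists j, [/\ (j < k)%N, tau j < s, s <= tau j.+1 &
    \sum_(i < k) c i * \1_(`]tau i, tau i.+1]) s = c j].
Proof.
move=> nd s0; elim: k => [|k IH sk]; first by rewrite leNgt s0.
have [{}/IH [j [jk js sj E]]|ks] := leP s (tau k).
  exists j; split=> //; first exact: ltnW.
  have ndj i : (j < i)%N -> tau j.+1 <= tau i.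
    elim: i => // i IHi; rewrite ltnS leq_eqVlt => /predU1P[->//|/IHi /le_trans]; exact.
  rewrite big_ord_recr/= E indicE memNset ?mulr0 ?addr0//= in_itv/=.
  by apply/negP; rewrite negb_and -leNgt (le_trans sj)// ndj.
exists k; split=> //; rewrite big_ord_recr/= big1 ?add0r.
  by rewrite indicE mem_set ?mulr1//= in_itv/= ks.
have ndk i j : (i <= j)%N -> tau i <= tau j.
  elim: j => [|j IHj]; first by rewrite leqn0 => /eqP->.
  by rewrite leq_eqVlt => /predU1P[->//|]; rewrite ltnS => /IHj /le_trans; exact.
move=> i _; rewrite indicE memNset ?mulr0//= in_itv/=.
by apply/negP; rewrite negb_and -!ltNge (le_lt_trans (ndk i.+1 k _) ks) ?orbT.
Qed.

(** The terms are [(k + 2)^(-(1 + q))]. They telescope against [b k = (k + 1)^(-q)], because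
    [ln (x + 1) - ln x >= 1 / (x + 1)] gives [q (x + 1)^(-(1 + q)) <= x^(-q) - (x + 1)^(-q)]. *)
Lemma pseries_bound (q : R) n : 0 < q ->
  \sum_(k < n) expR (- (1 + q) * ln (k.+2%:R : R)) <= q^-1.
Proof.
move=> q0; pose b k := expR (- q * ln (k.+1%:R : R)).
suff H : \sum_(k < n) expR (- (1 + q) * ln (k.+2%:R : R)) <= q^-1 * (1 - b n).
  by rewrite (le_trans H)// ler_piMr ?invr_ge0 ?(ltW q0)// gerBl expR_ge0.
elim: n => [|n IH]; first by rewrite big_ord0 /b ln1 mulr0 expR0 subrr mulr0.
rewrite big_ord_recr/= (le_trans (lerD IH (lexx _)))//.
rewrite -lerBrDl -mulrBr ler_pdivlMl//.
have -> : 1 - b n.+1 - (1 - b n) = b n - b n.+1 by ring.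
rewrite /b; set x : R := n.+1%:R; have x0 : 0 < x by rewrite ltr0n.
have -> : n.+2%:R = x + 1 :> R by rewrite /x natr1.
have x1 : 0 < x + 1 by rewrite addr_gt0.
have lnx : (x + 1)^-1 <= ln (x + 1) - ln x.
  have := expR_ge1Dx (ln x - ln (x + 1)); rewrite expRB !lnK ?posrE//.
  have -> : x / (x + 1) = 1 - (x + 1)^-1 by field; rewrite gt_eqF.
  lra.
rewrite lerBrDr.
have -> : - (1 + q) * ln (x + 1) = - q * ln (x + 1) - ln (x + 1) by ring.
rewrite expRD expRN lnK ?posrE// mulrA mulrAC -[X in _ + X]mul1r -mulrDl.
apply: (@le_trans _ _ (expR (q * (ln (x + 1) - ln x)) * expR (- q * ln (x + 1)))); last first.
  by rewrite -expRD ler_expR; lra.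
rewrite ler_wpM2r ?expR_ge0//; apply: le_trans (expR_ge1Dx _).
by rewrite addrC lerD2l ler_wpM2l// ltW.
Qed.

End deterministic_integrand.

(** * Tail bounds for the Ito integral on finite grids *)

Section ito_tail.
Context {R : realType} {d : measure_display} {T : measurableType d}.
Variables (P : probability T R) (Filt : R -> set (set T)) (B : R -> T -> R).
Hypotheses (uF : usual_filtration P Filt) (bB : brownian_motion P Filt B).
Variable sigma : R -> R.
Hypothesis csigma : {within `[0, +oo[, continuous sigma}.
Implicit Types (h s t u a : R) (c : nat -> R).
Notation leb := (@lebesgue_measure R).
Notation V := (variance_clock sigma).

Definition grid_process k h c : @simple_process R d T :=
  SimpleProcess k (fun j => j%:R * h) (fun j _ => c j).

Lemma grid_is_simple k h c : 0 <= h -> is_simple Filt (k%:R * h) (grid_process k h c).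
Proof.
move=> h0; split=> //=; first by rewrite mul0r.
- by move=> i _; rewrite ler_wpM2r// ler_nat.
- move=> i _; apply: measurable_wrt_cst.
  by case: uF => sF _ _ _ _; apply: sF; rewrite mulr_ge0.
exists (\sum_(j < k) `|c j|) => i w ik.
by rewrite (bigD1 (Ordinal ik))//= lerDl; apply: sumr_ge0.
Qed.

Lemma grid_approximates u (k : nat -> nat) (h : nat -> R) (c : nat -> nat -> R) :
  (forall n, 0 < h n) -> h n @[n --> \oo] --> 0 ->
  (forall n, (k n)%:R * h n = u) ->
  (forall n j, exists2 x, j%:R * h n <= x <= j.+1%:R * h n & c n j = sigma x) ->
  approximates P Filt (fun s _ => sigma s) u (fun n => grid_process (k n) (h n) (c n)).
Proof.
move=> h0 hlim kh cx.
have u0 : 0 <= u by rewrite -(kh 0%N) mulr_ge0// ltW.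
split; first by move=> n; rewrite -(kh n); apply: grid_is_simple; exact: ltW.
pose val n s := \sum_(i < k n) c n i * \1_(`]i%:R * h n, i.+1%:R * h n]) s.
pose D n := (\int[leb]_(s in `[0%R, u]) ((sigma s - val n s) ^+ 2)%:E)%E.
have D0 n : (0 <= D n)%E by apply: integral_ge0 => s _; rewrite lee_fin sqr_ge0.
suff : D n @[n --> \oo] --> 0%E.
  apply: cvg_trans; apply: near_eq_cvg; apply: nearW => n /=.
  rewrite (_ : (fun w : T => _) = cst (D n)); last by [].
  by rewrite integral_cst//= probability_setT mule1.
apply/ge0_cvge0P => // e e0.
have cs : continuous (fun x : R => sigma (Num.max x 0)) by exact: continuous_maxl.
(* Chosen so that [e' ^+ 2 * u <= e]; dividing by [u + 1] also covers [u = 0]. *)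
pose e' := Num.sqrt (e / (u + 1)).
have u1 : 0 < u + 1 by rewrite ltr_wpDl.
have e'0 : 0 < e' by rewrite sqrtr_gt0 divr_gt0.
have [del del0 Hdel] := uniform_continuity_itv u cs e'0.
have /cvgrPdist_lt/(_ _ del0) hdel := hlim.
apply: filterS hdel => n; rewrite sub0r normrN gtr0_norm// => hn.
have msig : measurable_fun (`]0, u] : set R) sigma.
  apply: (@measurable_funS _ _ _ _ (`[0, +oo[ : set R)) => //.
    by move=> x /=; rewrite !in_itv/= andbT => /andP[/ltW].
  exact: subspace_continuous_measurable_fun.
have mval : measurable_fun (`]0, u] : set R) (val n).
  apply: measurable_sum => i; apply: measurable_funM; first exact: measurable_cst.
  exact: measurable_indic.
have mD : measurable_fun (`]0, u] : set R) (fun s => ((sigma s - val n s) ^+ 2)%:E).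
  by apply/measurable_EFinP; apply: measurable_funX; exact: measurable_funB.
(* Time 0 lies in no cell, so the step function is 0 there and may be far from [sigma 0]; dropping
   this null point leaves the integral unchanged. *)
rewrite /D -integral_itv_obnd_cbnd//.
apply: (@le_trans _ _ (\int[leb]_(s in `]0%R, u]) (e' ^+ 2)%:E)%E).
  apply: ge0_le_integral => //=.
  - by move=> s _; rewrite lee_fin sqr_ge0.
  move=> s; rewrite in_itv/= => /andP[s0 su].
  have nd j : j%:R * h n <= j.+1%:R * h n by rewrite ler_wpM2r ?ler_nat ?(ltW (h0 n)).
  have s0' : 0%:R * h n < s by rewrite mul0r.
  have su' : s <= (k n)%:R * h n by rewrite kh.
  have [j [_ js sj E]] := step_valueP (c n) nd s0' su'.
  rewrite lee_fin /val E; have [x /andP[jx xj] ->] := cx n j.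
  have x0 : 0 <= x by apply: le_trans jx; rewrite mulr_ge0// ltW.
  have := Hdel s x (ltW s0) su.
  rewrite !max_l ?(ltW s0)// => /(_ _)/wrap[|].
    rewrite ltr_norml; move: hn jx xj js sj; rewrite -natr1 mulrDl mul1r.
    by move=> hn jx xj js sj; apply/andP; split; lra.
  by move=> H; rewrite -[leLHS]real_normK ?num_real// lerXn2r// nnegrE ltW.
rewrite integral_cst//= lebesgue_measure_itv/= lte_fin.
rewrite sqr_sqrtr ?divr_ge0 ?(ltW e0) ?(ltW u1)//.
case: ifPn => _; last by rewrite mule0 lee_fin ltW.
by rewrite -EFinD -EFinM lee_fin oppr0 addr0 mulrAC ler_pdivrMr// ler_pM2l// lerDl.
Qed.

(* Minimizing [|sigma|] on each cell keeps the variance of the discretized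
   integral below the clock [V], see [grid_variance]. *)
Lemma grid_minimal h : 0 < h -> exists c : nat -> R, forall j,
  (exists2 x, j%:R * h <= x <= j.+1%:R * h & c j = sigma x) /\
  c j ^+ 2 * h <= \int[leb]_(s in `[j%:R * h, j.+1%:R * h]) sigma s ^+ 2.
Proof.
move=> h0; suff /choice[c Hc] : forall j : nat, exists cj : R,
  (exists2 x, j%:R * h <= x <= j.+1%:R * h & cj = sigma x) /\
  cj ^+ 2 * h <= \int[leb]_(s in `[j%:R * h, j.+1%:R * h]) sigma s ^+ 2.
  by exists c.
move=> j.
have jh : j%:R * h <= j.+1%:R * h by rewrite ler_wpM2r ?ler_nat ?(ltW h0).
have jh0 : 0 <= j%:R * h by rewrite mulr_ge0// ltW.
have cs2 : {within `[j%:R * h, j.+1%:R * h], continuous (fun s => sigma s ^+ 2)}.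
  apply: (within_itvcc_sub _ (@within_sqr_sigma _ _ csigma (j.+1%:R * h))) => x /andP[jx xj].
  by rewrite /= in_itv/= (le_trans jh0).
have [x xj Hx] := EVT_min jh cs2.
exists (sigma x); split; first by exists x => //; move: xj; rewrite in_itv.
have hE : j.+1%:R * h - j%:R * h = h by rewrite -natr1 mulrDl mul1r addrAC subrr add0r.
rewrite -[X in _ * X <= _]hE -(Rintegral_cst_itv _ jh).
apply: le_Rintegral => //=.
- by apply: continuous_integrable => ?; exact: cvg_cst.
- exact: within_integrable.
Qed.

Lemma grid_variance h c k : 0 < h ->
  (forall j, c j ^+ 2 * h <= \int[leb]_(s in `[j%:R * h, j.+1%:R * h]) sigma s ^+ 2) ->
  sum_variance (fun j => j%:R * h) c k <= V (k%:R * h).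
Proof.
move=> h0 Hc; have hS j : j.+1%:R * h - j%:R * h = h.
  by rewrite -natr1 mulrDl mul1r addrAC subrr add0r.
elim: k => [|k IH]; first by rewrite /sum_variance big_ord0 variance_clock_ge0.
rewrite /sum_variance big_ord_recr/= hS /variance_clock.
have k0 : 0 <= k%:R * h by rewrite mulr_ge0// ltW.
have kk1 : k%:R * h <= k.+1%:R * h by rewrite ler_wpM2r ?ler_nat ?(ltW h0).
rewrite (Rintegral_cat k0 kk1); first exact: lerD.
exact: integrable_sqr_sigma.
Qed.

Variable I : R -> T -> R.
Hypothesis itoI : forall t, 0 <= t -> is_ito_integral P Filt B (fun s _ => sigma s) t (I t).

Let mF t : 0 <= t -> Filt t `<=` measurable.
Proof. by case: uF => _ + _ _ _; exact. Qed.

Let mI t : 0 <= t -> measurable_fun setT (I t).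
Proof. by move=> /itoI[]. Qed.

Local Open Scope ereal_scope.

Lemma ge0_markov_sqr (Z : T -> R) (del : R) : measurable_fun setT Z -> (0 < del)%R ->
  (del ^+ 2)%:E * P [set w | (del <= `|Z w|)%R] <= \int[P]_w (Z w ^+ 2)%:E.
Proof.
move=> mZ del0.
have mE : measurable [set w | (del <= `|Z w|)%R].
  rewrite (_ : [set w | _] = (fun w => `|Z w|%R) @^-1` `[del, +oo[); last first.
    by apply/seteqP; split=> w /=; rewrite in_itv/= andbT.
  rewrite -[X in measurable X]setTI; apply: (measurableT_comp _ mZ) => //.
rewrite -[X in P X]setIT -integral_indic// -ge0_integralZl//; last 2 first.
- exact/measurable_EFinP/measurable_indic.
- by rewrite lee_fin sqr_ge0.
apply: ge0_le_integral => //.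
- by move=> w _; rewrite -EFinM lee_fin mulr_ge0 ?sqr_ge0.
- by apply: measurable_funeM; exact/measurable_EFinP/measurable_indic.
- by apply/measurable_EFinP; apply: measurable_funX.
move=> w _; rewrite -EFinM lee_fin indicE; have [|_] := boolP (_ \in _).
  rewrite inE/= => H; rewrite mulr1 -[leRHS]real_normK ?num_real//.
  by rewrite lerXn2r// nnegrE ltW.
by rewrite mulr0 sqr_ge0.
Qed.

Lemma measurable_abs_gt t (a : R) : (0 <= t)%R -> measurable [set w | (a < `|I t w|)%R].
Proof.
move=> t0; rewrite (_ : [set w | _] = (fun w => `|I t w|%R) @^-1` `]a, +oo[); last first.
  by apply/seteqP; split=> w /=; rewrite in_itv/= andbT.
rewrite -[X in measurable X]setTI.
exact: (measurableT_comp (@normr_measurable R setT) (mI t0)).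
Qed.

Definition tail_grid t (a : R) m :=
  \bigcup_(i in [set i | (i <= m)%N]) [set w | (a < `|I (i%:R * (t / m%:R)) w|)%R].

Lemma measurable_tail_grid t (a : R) m : (0 <= t)%R -> measurable (tail_grid t a m).
Proof.
move=> t0; apply: bigcup_measurable => i _; apply: measurable_abs_gt.
by rewrite mulr_ge0// divr_ge0.
Qed.

(** The [m + 1] observation times stay fixed while the sums use [m * n.+1] steps. Outside an event
    of small probability the sums are within [a - a'] of [I] at all these times, so where [|I|]
    exceeds [a] a sum or its negative exceeds [a']; the two signs give the factor 2. *)
Lemma tail_grid_bound t (a a' la : R) m : (0 < t)%R -> (0 < m)%N ->
  (0 <= a')%R -> (a' < a)%R -> (0 <= la)%R ->
  P (tail_grid t a m) <= (2 * expR (la ^+ 2 * V t / 2 - la * a'))%:E.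
Proof.
move=> t0 m0 a'0 a'a la0.
have mR0 : (0 < m%:R :> R)%R by rewrite ltr0n.
pose h n : R := (t / (m * n.+1)%:R)%R.
have h0 n : (0 < h n)%R by rewrite divr_gt0// ltr0n muln_gt0 m0.
have hlim : (h n @[n --> \oo] --> 0)%R.
  rewrite (_ : h = fun n => t / m%:R * n.+1%:R^-1)%R; last first.
    by apply/funext => n; rewrite /h natrM invfM mulrA.
  by rewrite -[X in _ --> X](mulr0 (t / m%:R)%R); apply: cvgM;
    [exact: cvg_cst|exact: cvg_harmonic].
have /choice[c Hc] := fun n => grid_minimal (h0 n).
have hk n i : ((i * n.+1)%:R * h n = i%:R * (t / m%:R))%R.
  by rewrite /h !natrM; field; rewrite (gt_eqF mR0)/= nat1r pnatr_eq0.
have tauS n j : (j%:R * h n < j.+1%:R * h n)%R by rewrite ltr_pM2r// ltr_nat.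
pose S n i w := brownian_sum B (fun j => j%:R * h n)%R (c n) (i * n.+1) w.
have u0 i : (0 <= i%:R * (t / m%:R))%R by rewrite mulr_ge0// divr_ge0// ltW.
have mS n i : measurable_fun setT (S n i).
  have tau0 : (0%:R * h n)%R = 0%R by rewrite mul0r.
  apply: (measurable_wrtW (mF (u0 i))); rewrite -(hk n).
  exact: (measurable_brownian_sum uF bB (c n) tau0 (tauS n)).
have conv i : \int[P]_w ((I (i%:R * (t / m%:R)) w - S n i w) ^+ 2)%:E @[n --> \oo] --> 0.
  have cx n j := (Hc n j).1.
  have [_ _ itoE] := itoI (u0 i).
  exact: (itoE _ (grid_approximates h0 hlim (fun n => hk n i) cx)).
have del0 : (0 < a - a')%R by rewrite subr_gt0.
apply/lee_addgt0Pr => e e0.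
(* With this mean square error Chebyshev's inequality gives each of the [m.+1] bad events
   probability at most [e / m.+1]. *)
pose e' := ((a - a') ^+ 2 * (e / m.+1%:R))%R.
have e'0 : (0 < e')%R by rewrite mulr_gt0 ?exprn_gt0// divr_gt0.
have : \forall n \near \oo, forall i : 'I_m.+1,
    \int[P]_w ((I (i%:R * (t / m%:R)) w - S n i w) ^+ 2)%:E <= e'%:E.
  apply: filter_forall => i; have := conv i; rewrite ge0_cvge0P; last first.
    by move=> n; apply: integral_ge0 => w _; rewrite lee_fin sqr_ge0.
  exact.
move=> [n0 _ /(_ n0 (leqnn _))] /= Hn0.
pose Bad i := [set w | (a - a' <= `|I (i%:R * (t / m%:R)) w - S n0 i w|)%R].
have mBad i : measurable (Bad i).
  rewrite (_ : Bad i = (fun w => `|I (i%:R * (t / m%:R)) w - S n0 i w|%R) @^-1` `[(a - a')%R, +oo[).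
    rewrite -[X in measurable X]setTI.
    apply: (measurableT_comp (@normr_measurable R setT)) => //.
    exact: measurable_funB (mI (u0 i)) (mS n0 i).
  by apply/seteqP; split=> w /=; rewrite in_itv/= andbT.
have PBad (i : 'I_m.+1) : P (Bad i) <= (e / m.+1%:R)%:E.
  have mZ : measurable_fun setT (fun w => I (i%:R * (t / m%:R)) w - S n0 i w)%R.
    exact: measurable_funB (mI (u0 i)) (mS n0 i).
  have := le_trans (ge0_markov_sqr mZ del0) (Hn0 i).
  by rewrite /e' (EFinM (_ ^+ 2)) lee_pmul2l// ?lte_fin ?exprn_gt0.
pose tau j := (j%:R * h n0)%R.
have tau0 : tau 0%N = 0%R by rewrite /tau mul0r.
pose k := (m * n0.+1)%N.
(* Negated coefficients have the same variance and turn the lower tail into an upper one. *)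
pose c' j := (- c n0 j)%R.
have tk : (k%:R * h n0)%R = t by rewrite hk mulrC divfK// gt_eqF.
have Vk : (sum_variance tau (c n0) k <= V t)%R.
  by rewrite -tk; apply: grid_variance => // j; case: (Hc n0 j).
have Vk' : sum_variance tau c' k = sum_variance tau (c n0) k.
  by apply: eq_bigr => j _; rewrite sqrrN.
pose Up := ~` below_level B tau (c n0) a' k.
pose Down := ~` below_level B tau c' a' k.
have PUp : P Up <= (expR (la ^+ 2 * V t / 2 - la * a'))%:E.
  apply: (le_trans (brownian_sum_maximal uF bB (c n0) tau0 (tauS n0) a'0 la0 k)).
  by rewrite lee_fin ler_expR lerD2r ler_pM2r// ler_wpM2l// sqr_ge0.
have PDown : P Down <= (expR (la ^+ 2 * V t / 2 - la * a'))%:E.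
  apply: (le_trans (brownian_sum_maximal uF bB c' tau0 (tauS n0) a'0 la0 k)).
  by rewrite lee_fin ler_expR lerD2r ler_pM2r// ler_wpM2l// ?sqr_ge0// Vk'.
have mUp : measurable Up.
  apply: measurableC; apply: (mF (u0 m)); rewrite -(hk n0).
  exact: (measurable_below_level uF bB _ tau0 (tauS n0)).
have mDown : measurable Down.
  apply: measurableC; apply: (mF (u0 m)); rewrite -(hk n0).
  exact: (measurable_below_level uF bB _ tau0 (tauS n0)).
have mBads : measurable (\big[setU/set0]_(i < m.+1) Bad i).
  by apply: bigsetU_measurable => i _; exact: mBad.
have sub : tail_grid t a m `<=` (Up `|` Down) `|` \big[setU/set0]_(i < m.+1) Bad i.
  move=> w [i /= im Iw]; have [bad|good] := leP (a - a')%R (`|I (i%:R * (t / m%:R)) w - S n0 i w|)%R.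
    by right; rewrite -bigcup_mkord; exists i => //=; rewrite ltnS.
  left; have : (a' < `|S n0 i w|)%R.
    have := ler_normD (I (i%:R * (t / m%:R)) w - S n0 i w)%R (S n0 i w).
    by rewrite subrK; lra.
  have ik : (i * n0.+1 <= k)%N by rewrite leq_mul2r im orbT.
  rewrite ltr_normr => /orP[H|H]; [left|right] => /(_ _ ik); apply/negP; rewrite -ltNge//.
  suff -> : brownian_sum B tau c' (i * n0.+1) w = (- S n0 i w)%R by [].
  by rewrite /S /brownian_sum -sumrN; apply: eq_bigr => j _; rewrite mulNr.
apply: (le_trans (le_measure P _ _ sub)); rewrite ?inE.
- exact/measurable_tail_grid/ltW.
- by apply: measurableU => //; exact: measurableU.
apply: (le_trans (measureU2 _ _ _)) => //; first exact: measurableU.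
apply: leeD.
  apply: (le_trans (measureU2 _ _ _)) => //.
  by rewrite mulrDl mul1r EFinD; apply: leeD.
apply: (le_trans (Boole_inequality _ _)) => //.
apply: (@le_trans _ _ (\sum_(i < m.+1) (e / m.+1%:R)%:E)); first by apply: lee_sum => i _; exact: PBad.
by rewrite sumEFin sumr_const card_ord lee_fin -[leLHS]mulr_natr divfK// pnatr_eq0.
Qed.

End ito_tail.

(** * Law of the iterated logarithm, upper bound *)

Section iterated_logarithm.
Context {R : realType} {d : measure_display} {T : measurableType d}.
Variables (P : probability T R) (Filt : R -> set (set T)) (B : R -> T -> R).
Hypotheses (uF : usual_filtration P Filt) (bB : brownian_motion P Filt B).
Variable sigma : R -> R.
Hypothesis csigma : {within `[0, +oo[, continuous sigma}.
Notation leb := (@lebesgue_measure R).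
Notation V := (variance_clock sigma).
Variable I : R -> T -> R.
Hypothesis itoI : forall t, 0 <= t -> is_ito_integral P Filt B (fun s _ => sigma s) t (I t).

Lemma tail_grid_double t a m : (0 < m)%N -> tail_grid I t a m `<=` tail_grid I t a (2 * m).
Proof.
move=> m0 w [i /= im Iw]; exists (2 * i)%N => /=; first by rewrite leq_mul2l.
rewrite (_ : _ * _ = i%:R * (t / m%:R))//.
by rewrite !natrM; field; rewrite pnatr_eq0 -lt0n.
Qed.

(** By continuity [|I|] exceeds [a] on a neighbourhood of [s]. A dyadic grid finer than its radius
    meets it at the last grid point before [s], which is still at most [t]. *)
Lemma sup_subset_tail_grid t a w s : 0 < t -> {within `[0, +oo[, continuous (I ^~ w)} ->
  0 <= s -> s <= t -> a < `|I s w| -> exists K, tail_grid I t a (2 ^ K) w.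
Proof.
move=> t0 cI s0 st Is.
have cI' : continuous (fun x : R => `|I (Num.max x 0) w|).
  by move=> x; apply: cvg_norm; exact: (continuous_maxl cI).
have Is' : a < `|I (Num.max s 0) w| by rewrite max_l.
have [r /= r0 Hr] := cvgr_gt _ (cI' s) _ Is'.
pose K := (Num.truncn (t / r)).+1; exists K.
pose h := t / (2 ^ K)%:R.
have p0 : 0 < (2 ^ K)%:R :> R by rewrite ltr0n expn_gt0.
have h0 : 0 < h by rewrite divr_gt0.
have hr : h < r.
  rewrite ltr_pdivrMr// mulrC -ltr_pdivrMr// (lt_trans (truncnS_gt _))// -/K ltr_nat.
  exact: ltn_expl.
pose i := Num.truncn (s / h).
have sh0 : 0 <= s / h by rewrite divr_ge0// ltW.
have /andP[ih hi] := truncn_itv sh0.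
rewrite ler_pdivlMr// in ih; rewrite ltr_pdivrMr// -natr1 mulrDl mul1r in hi.
exists i => /=.
  rewrite -(ler_nat R) -(ler_pM2r h0) (le_trans ih)// (le_trans st)//.
  by rewrite /h mulrC divfK// gt_eqF.
have : a < `|I (Num.max (i%:R * h) 0) w|.
  apply: Hr => /=; rewrite (lt_trans _ hr)// ger0_norm ?subr_ge0//.
  by rewrite ltrBlDr addrC.
by rewrite max_l// mulr_ge0// ltW.
Qed.

Local Open Scope ereal_scope.

(** [E] is the increasing union of the dyadic grid events, so their common bound survives in the
    limit. It is measurable by construction, which avoids a supremum over uncountably many times. *)
Lemma ito_sup_tail t (a a' la : R) : (0 < t)%R -> (0 <= a')%R -> (a' < a)%R -> (0 <= la)%R ->
  exists E, [/\ measurable E, P E <= (2 * expR (la ^+ 2 * V t / 2 - la * a'))%:E &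
    forall w s, {within `[0%R, +oo[, continuous (I ^~ w)} ->
      (0 <= s)%R -> (s <= t)%R -> (a < `|I s w|)%R -> E w].
Proof.
move=> t0 a'0 a'a la0; pose G K := tail_grid I t a (2 ^ K).
have mG K : measurable (G K) by apply: (measurable_tail_grid itoI); exact: ltW.
have ndG : nondecreasing_seq G.
  apply/nondecreasing_seqP => K; apply/subsetPset; rewrite /G expnS.
  by apply: tail_grid_double; rewrite expn_gt0.
have mE : measurable (\bigcup_K G K) by exact: bigcup_measurable.
exists (\bigcup_K G K); split=> //.
  have Gcvg := nondecreasing_cvg_mu (mu := P) mG mE ndG.
  rewrite -(cvg_lim _ Gcvg)//; apply: lime_le; first by apply/cvg_ex; eexists; exact: Gcvg.
  apply: nearW => K; apply: (tail_grid_bound uF bB csigma itoI) => //.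
  by rewrite expn_gt0.
by move=> w s cI s0 st Is; have [K] := sup_subset_tail_grid t0 cI s0 st Is; exists K.
Qed.

Local Close Scope ereal_scope.

(** [la = a' / V t] minimizes [la ^+ 2 * V t / 2 - la * a'], with minimum [- a' ^+ 2 / (2 * V t)].
    Since [V t = (1 + e / 2) * V s], one of the two factors [1 + e / 2] in [a' ^+ 2] survives, and
    the minimum is [-(1 + e / 2)] times [ln (ln (V s)) = ln c + ln (k + k0)]: the tail is a summable
    power of [k]. *)
Lemma ito_block_tail (e c : R) k k0 : 0 < e -> 0 < c -> expR c = 1 + e / 2 ->
  (1 < k0)%N -> forall s t, 0 < t -> V s = expR (c * (k + k0)%:R) ->
  V t = expR (c * (k.+1 + k0)%:R) -> 0 < Sigma sigma s ->
  exists E, [/\ measurable E,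
    (P E <= (2 * expR (- (1 + e / 2) * ln c) *
             expR (- (1 + e / 2) * ln (k.+2%:R : R)))%:E)%E &
    forall w r, {within `[0, +oo[, continuous (I ^~ w)} ->
      0 <= r -> r <= t -> (1 + e) * Sigma sigma s < `|I r w| -> E w].
Proof.
move=> e0 c0 ce k02 s t t0 Vs Vt S0; set a := (1 + e) * _.
pose a' := (1 + e / 2) * Sigma sigma s.
have a'0 : 0 <= a' by rewrite mulr_ge0 ?(ltW S0)// addr_ge0 ?divr_ge0 ?(ltW e0).
have a'a : a' < a by rewrite /a' /a ltr_pM2r//; lra.
have Vt0 : 0 < V t by rewrite Vt expR_gt0.
have la0 : 0 <= a' / V t by rewrite divr_ge0// ltW.
have [E [mE PE HE]] := ito_sup_tail t0 a'0 a'a la0.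
exists E; split=> //; apply: (le_trans PE); rewrite lee_fin -[leRHS]mulrA ler_pM2l//.
rewrite -expRD ler_expR.
have k0R : 0 < (k + k0)%:R :> R by rewrite ltr0n addn_gt0 (ltn_trans _ k02) ?orbT.
have lnE : ln (ln (V s)) = ln c + ln ((k + k0)%:R : R).
  by rewrite Vs expRK lnM ?posrE.
have Vts : V t = V s * (1 + e / 2).
  by rewrite Vt Vs -ce -expRD; congr expR; rewrite addSn -natr1; ring.
have Vs0 : 0 < V s by rewrite Vs expR_gt0.
(* The radicand is nonnegative, since otherwise the square root would be 0, against [S0]. *)
have S2 : Sigma sigma s ^+ 2 = 2 * V s * (ln c + ln ((k + k0)%:R : R)).
  rewrite -lnE sqr_sqrtr// leNgt; apply/negP => neg.
  by move: S0; rewrite /Sigma ler0_sqrtr ?ltxx// ltW.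
have -> : (a' / V t) ^+ 2 * V t / 2 - a' / V t * a' =
    - (1 + e / 2) * (ln c + ln ((k + k0)%:R : R)).
  have -> : (a' / V t) ^+ 2 * V t / 2 - a' / V t * a' = - a' ^+ 2 / (2 * V t).
    by field; rewrite gt_eqF.
  rewrite /a' exprMn S2 Vts; field.
  by rewrite (gt_eqF Vs0) gt_eqF//; lra.
have : ln (k.+2%:R : R) <= ln ((k + k0)%:R : R).
  have kk : (k.+2 <= k + k0)%N by rewrite -addn2 leq_add2l.
  by rewrite ler_ln ?posrE// ler_nat.
have e20 : 0 <= 1 + e / 2 by lra.
by move/(ler_wpM2l e20); lra.
Qed.

Hypothesis cI : ae_continuous P I.
Hypothesis sigmaN : ~ leb.-integrable `]0, +oo[ (fun s => (sigma s ^+ 2)%:E).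
Variable t0 : R.
Hypothesis t0e : expR 1 < V t0.

(* Borel-Cantelli along [V (tau k) = expR (c * (k + k0))], i.e. with ratio
   [expR c = 1 + e / 2]; the block probabilities are [O(k ^ (- (1 + e / 2)))]. *)
Lemma iterated_logarithm_ub e : 0 < e ->
  {ae P, forall w, \forall t \near +oo, `|I t w| <= (1 + e) * Sigma sigma t}.
Proof.
move=> e0; pose c := ln (1 + e / 2).
have e2 : 0 < 1 + e / 2 by lra.
have ce : expR c = 1 + e / 2 by rewrite lnK.
have c0 : 0 < c by rewrite -(ln1 R) ltr_ln ?posrE//; lra.
(* Large enough for [c * k0 >= V t0], so that [expR x >= 1 + x] puts all prescribed clock values
   above [V t0]; the extra unit yields [1 < k0]. *)
pose k0 := (Num.truncn (V t0 / c)).+2.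
have k02 : (1 < k0)%N by [].
have Vk0 k : V t0 <= expR (c * (k + k0)%:R).
  apply: le_trans (expR_ge1Dx _); apply: (@le_trans _ _ (c * k0%:R)).
    rewrite mulrC -ler_pdivrMr// ltW// (lt_trans (truncnS_gt _))//.
    by rewrite ltr_nat.
  by rewrite ler_wpDl// ler_pM2l// ler_nat leq_addl.
have t00 := clock_start_gt0 t0e.
have /choice[tau Htau] : forall k : nat, exists t, t0 <= t /\ V t = expR (c * (k + k0)%:R).
  by move=> k; have [t] := variance_clock_surj csigma sigmaN t00 (Vk0 k); exists t.
have tau0 k : 0 < tau k by rewrite (lt_le_trans t00)//; case: (Htau k).
have S0 t : t0 <= t -> 0 < Sigma sigma t.
  move=> tt; have eV : expR 1 < V t by rewrite (lt_le_trans t0e)// variance_clock_nd.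
  have V0 : 0 < V t by rewrite (lt_trans _ eV)// expR_gt0.
  have lV : 1 < ln (V t) by rewrite -[ltLHS]expRK ltr_ln// posrE expR_gt0.
  by rewrite sqrtr_gt0 mulr_gt0 ?mulr_gt0// ln_gt0.
have /choice[E HE] := fun k => ito_block_tail e0 c0 ce k02 (tau0 k.+1) (Htau k).2
  (Htau k.+1).2 (S0 _ (Htau k).1).
have mE k : measurable (E k) by case: (HE k).
pose C := 2 * expR (- (1 + e / 2) * ln c).
have C0 : 0 <= C by rewrite mulr_ge0// expR_ge0.
have sumE : (\sum_(k <oo) P (E k) < +oo)%E.
  apply: (@le_lt_trans _ _ (C * (e / 2)^-1)%:E); last exact: ltry.
  apply: lime_le; first by apply: is_cvg_nneseries => k _ _; exact: measure_ge0.
  apply: nearW => n; apply: (@le_trans _ _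
      (\sum_(0 <= k < n) (C * expR (- (1 + e / 2) * ln (k.+2%:R : R)))%:E)%E).
    by apply: lee_sum => k _; case: (HE k).
  rewrite sumEFin lee_fin -mulr_sumr ler_wpM2l// big_mkord; apply: pseries_bound.
  by rewrite divr_gt0.
have P0 := lim_sup_set_cvg0 mE sumE.
have mlim : measurable (lim_sup_set E).
  by apply: bigcap_measurable => // n _; exact: bigcup_measurable.
have aeE : {ae P, forall w, ~ lim_sup_set E w}.
  by exists (lim_sup_set E); split=> // w /= /contrapT.
have tau_lt k : tau k < tau k.+1.
  rewrite ltNge; apply/negP => /(variance_clock_nd csigma).
  by rewrite (Htau k).2 (Htau k.+1).2 ler_expR ler_pM2l// ler_nat addSn ltnn.
apply: filterS2 aeE cI => w Ew cIw.
have [n Hn] : exists n, forall k, (n <= k)%N -> ~ E k w.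
  apply: contrapT => H; apply: Ew => n _; apply: contrapT => H2; apply: H.
  by exists n => k nk Ek; apply: H2; exists k.
apply/near_pinftyP; exists (tau n) => t nt.
(* [k.+1] is the least index whose time exceeds [t]; one exists because the prescribed clock values
   eventually exceed [V t]. *)
have [k [nk kt tk]] : exists k, [/\ (n <= k)%N, tau k <= t & t < tau k.+1].
  have Vt : V t < expR (c * ((Num.truncn (V t / c)).+1 + k0)%:R).
    apply: lt_le_trans (expR_ge1Dx _); rewrite ltr_pwDl//.
    rewrite mulrC -ler_pdivrMr// ltW// (lt_le_trans (truncnS_gt _))//.
    by rewrite ler_nat leq_addr.
  have ex : exists j, t < tau j.
    exists (Num.truncn (V t / c)).+1; rewrite ltNge; apply/negP => /(variance_clock_nd csigma).
    by rewrite (Htau _).2 leNgt Vt.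
  have tau_nd i j : (i <= j)%N -> tau i <= tau j.
    elim: j => [|j IHj]; first by rewrite leqn0 => /eqP->.
    by rewrite leq_eqVlt => /predU1P[->//|]; rewrite ltnS => /IHj /le_trans; apply; exact: ltW.
  case: (ex_minnP ex) => -[tj _|j tj jmin].
    by have := le_lt_trans (le_trans (tau_nd 0%N n (leq0n n)) nt) tj; rewrite ltxx.
  exists j; split=> //; last first.
    by rewrite leNgt; apply/negP => /jmin; rewrite ltnn.
  rewrite leqNgt; apply/negP => jn.
  by have := le_lt_trans (le_trans (tau_nd _ _ jn) nt) tj; rewrite ltxx.
have [_ _ Ek] := HE k.
have kt0 : t0 <= tau k := (Htau k).1.
(* [E k] controls [|I|] up to [tau k.+1] by [Sigma] at the left end [tau k]; monotonicity of [Sigma]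
   carries the bound to [t]. *)
apply: (@le_trans _ _ ((1 + e) * Sigma sigma (tau k))).
  rewrite leNgt; apply/negP => bad; apply: (Hn k nk); apply: (Ek w t cIw) => //; last exact: ltW.
  by rewrite (le_trans (ltW (tau0 k)))//.
apply: ler_wpM2l; first by lra.
exact: (Sigma_nd csigma t0e).
Qed.

End iterated_logarithm.

(** * The convolution term and the conclusion *)

Section convolution.
Context {R : realType}.
Notation leb := (@lebesgue_measure R).

Lemma locally_lipschitz_continuous (f : R -> R) : locally_lipschitz f -> continuous f.
Proof.
move=> lf x; have [U Ux /near_pinftyP[M HM]] := lf x.
pose M' := Num.max M 1; have M'0 : 0 < M' by rewrite lt_max ltr01 orbT.
have {}HM : M'.-lipschitz_on f (globally (U `*` U)) by apply: HM; rewrite le_max lexx.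
have Uxx : U x by exact: nbhs_singleton.
apply/cvgrPdist_lt => e e0.
have : \forall y \near x, `|x - y| < e / M'.
  by apply: nbhsx_ballx; rewrite divr_gt0.
apply: filterS2 Ux => y Uy; rewrite ltr_pdivlMr// mulrC; apply: le_lt_trans.
exact: (HM (x, y)).
Qed.

(** The kernel is nonincreasing in [s], hence measurable, and lies between 0 and the total mass;
    domination by the continuous [M * g] makes the integrand integrable. *)
Lemma convolution_le (mu : {measure set (measurableTypeR R) -> \bar R}) (g : R -> R) (t : R) :
  (mu `[0%R, +oo[%classic < +oo)%E -> 0 <= t -> {within `[0, t], continuous g} ->
  `|\int[leb]_(s in `[0, t]) (fine (mu `[0, t - s]%classic) * g s)| <=
  fine (mu `[0%R, +oo[%classic) * \int[leb]_(s in `[0, t]) `|g s|.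
Proof.
move=> muoo t0 cg; set M := fine _.
have mule r : (mu `[0%R, r]%classic <= mu `[0%R, +oo[%classic)%E.
  by apply: le_measure; rewrite ?inE//; apply: subset_itvl; rewrite bnd_simp.
have mufin r : mu `[0%R, r]%classic \is a fin_num.
  by rewrite ge0_fin_numE// (le_lt_trans (mule r)).
have mufinoo : mu `[0%R, +oo[%classic \is a fin_num by rewrite ge0_fin_numE.
pose m s := fine (mu `[0, t - s]%classic).
have m0 s : 0 <= m s by exact: fine_ge0.
have mM s : m s <= M by rewrite fine_le.
have mm : measurable_fun (`[0, t] : set R) m.
  apply: nonincreasing_measurable => // r s rs; rewrite fine_le//.
  apply: le_measure; rewrite ?inE//; apply: subset_itvl.
  by rewrite bnd_simp lerD2l lerN2.
have ig := within_integrable cg.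
have mg : measurable_fun (`[0, t] : set R) g.
  by apply/measurable_EFinP; case/integrableP: ig.
have iMg : leb.-integrable `[0, t] (EFin \o (fun s => M * g s)).
  by apply: within_integrable => x; apply: cvgM; [exact: cvg_cst|exact: cg].
have img : leb.-integrable `[0, t] (EFin \o (fun s => m s * g s)).
  apply: le_integrable iMg => //.
    by apply/measurable_EFinP; exact: measurable_funM.
  move=> s _ /=; rewrite lee_fin !normrM ler_wpM2r//.
  by rewrite !ger0_norm// (le_trans (m0 s)).
have ing : leb.-integrable `[0, t] (EFin \o (fun s => `|g s|)).
  by apply: within_integrable => x; apply: cvg_norm; exact: cg.
have cng : {within `[0, t], continuous (fun s => `|g s|)}.
  by move=> x; apply: cvg_norm; exact: cg.
have iMng : leb.-integrable `[0, t] (EFin \o (fun s => M * `|g s|)).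
  by apply: within_integrable => x; apply: cvgM; [exact: cvg_cst|exact: cng].
have inmg : leb.-integrable `[0, t] (EFin \o (fun s => `|m s * g s|)).
  by have := integrable_norm img.
apply: (le_trans (le_normr_Rintegral _ img)) => //.
rewrite -RintegralZl//; apply: le_Rintegral => //.
by move=> s _; rewrite normrM ger0_norm// ler_wpM2r.
Qed.

End convolution.

Theorem theorem3p7 (R : realType) (d : measure_display) (T : measurableType d)
  (P : probability T R) (Filt : R -> set (set T))
  (B : R -> T -> R) (X : R -> T -> R)
  (mu : {measure set (measurableTypeR R) -> \bar R})
  (sigma f phi dphi : R -> R) (t0 L : R) :
  usual_filtration P Filt ->
  brownian_motion P Filt B ->
  (0 < mu `[0%R, +oo[%classic < +oo)%E ->
  {within `[0, +oo[, continuous sigma} ->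
  ~ lebesgue_measure.-integrable `]0, +oo[ (fun s => (sigma s ^+ 2)%:E) ->
  locally_lipschitz f ->
  (forall x : R, 0 < x -> 0 < f x) ->
  f x @[x --> +oo] --> +oo ->
  C1_Rplus phi dphi ->
  (forall x : R, 0 <= x -> 0 < phi x) ->
  (forall x : R, 0 <= x -> 0 < dphi x) ->
  phi x @[x --> +oo] --> +oo ->
  (forall x y : R, 0 <= x -> x <= y -> dphi y <= dphi x) ->
  dphi x @[x --> +oo] --> 0 ->
  f x / phi x @[x --> +oo] --> (1 : R) ->
  `|f x| / phi `|x| @[x --> abs_pinfty_nbhs] --> (1 : R) ->
  is_solution P Filt B mu f sigma X ->
  expR 1 < variance_clock sigma t0 ->
  Sigma sigma t
    / (fine (mu `[0%R, +oo[%classic)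
       * \int[lebesgue_measure]_(s in `[t0, t]) f (Sigma sigma s))
    @[t --> +oo] --> L ->
  0 < L ->
  {ae P, forall w,
    (limf_esup
       (fun t : R => Fint f `|X t w| * ((fine (mu `[0%R, +oo[%classic) * t)^-1)%R%:E)
       +oo%R
     <= (1 + L)%R%:E)%E}.
Proof.
move=> uF bB /andP[mu0 muoo] csig sN lf fpos fy C1 phi0 dphi0 phiy _ _ fphi afphi.
move=> [aX cX [I [aI cI itoI eqX]]] t0e SL L0.
have cf := locally_lipschitz_continuous lf.
set M := fine _; have M0 : 0 < M by rewrite fine_gt0// mu0 muoo.
have t00 := clock_start_gt0 t0e.
(* Restricting to the countably many rates [1 / n.+1] keeps the union of exceptional sets null; an
   arbitrary [e > 0] is reached below by taking [n] with [1 / n.+1 <= e]. *)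
have lil : {ae P, forall w, forall n : nat,
    \forall t \near +oo, `|I t w| <= (1 + n.+1%:R^-1) * Sigma sigma t}.
  apply/ae_foralln => n; apply: (iterated_logarithm_ub uF bB csig itoI cI sN t0e).
  by rewrite invr_gt0.
apply: filterS3 cX eqX lil => w cXw eqXw lilw.
apply/lee_addgt0Pr => eta eta0; rewrite -EFinD.
have S0 t : 0 <= Sigma sigma t by exact: sqrtr_ge0.
have [T1 HT] : exists T1, forall t, T1 <= t ->
    (Fint f `|X t w| <= ((1 + L + eta) * (M * t))%:E)%E.
  apply/near_pinftyP.
  apply: (path_growth M0 L0 (ltW t00) eta0 cf fpos fy (C1_Rplus_continuous C1) phi0
    (C1_Rplus_nondecreasing C1 dphi0) fphi afphi (Sigma_continuous csig t0e) S0
    (Sigma_cvgy csig sN) SL cXw (A := `|X 0 w|) (I := I ^~ w)).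
    move=> t t_0; rewrite eqXw// (le_trans (ler_normD _ _))// lerD2r.
    rewrite (le_trans (ler_normD _ _))// lerD2l; apply: convolution_le => //.
    apply: (@within_continuous_comp _ _ _ _ (X ^~ w) f).
      by move=> y _; exact: cf.
    by apply: within_itvcc_sub cXw => s /andP[s0 _]; rewrite /= in_itv/= s0.
  move=> e e0; have := lilw (Num.truncn e^-1).
  apply: filterS => t /le_trans; apply; apply: ler_wpM2r => //; rewrite lerD2l.
  rewrite invf_ple ?posrE// ltW//; exact: truncnS_gt.
rewrite /limf_esup.
(* [limf_esup] is an infimum of suprema over neighbourhoods of [+oo], so one such set suffices; the
   bound 1 keeps the divisor [M * t] positive. *)
pose A := [set t | Num.max T1 1 <= t].
apply: (@le_trans _ _ (ereal_sup ((fun t => Fint f `|X t w| * ((M * t)^-1)%:E)%E @` A))).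
  apply: ereal_inf_lbound; exists A => //; apply/near_pinftyP.
  by exists (Num.max T1 1).
apply: ge_ereal_sup => _ [t /= At <-].
move: At; rewrite /A/= ge_max => /andP[/HT H t1].
by rewrite lee_pdivrMr// mulr_gt0// (lt_le_trans ltr01).
Qed.
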